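(* Let $\mathbb F$ be a field of characteristic $0$ and let $\mathbbm r$ be a noncommutative rational function over $\mathbb F$ in $z_1,\dots,z_g$. Then the dimension of a minimal realization of $\mathbbm r$ about a point $\underline p$ does not depend on the choice of the expansion point $\underline p\in\operatorname{dom}\mathbbm r$ (where $\operatorname{dom}\mathbbm r=\bigcup_{m}\operatorname{dom}_m\mathbbm r$ contains points of all matrix sizes $m$).
   Context: Rational expressions and functions: $\mathcal R_{\mathbb F}(\underline z)$ is the set of syntactically valid combinations of noncommutative polynomials over $\mathbb F$ in $\underline z=\{z_1,\dots,z_g\}$, operations $+,\cdot,{}^{-1}$ and parentheses. For $\underline a\in M_m(\mathbb F)^g$, $r(\underline a)$ is obtained by replacing $z_j$ by $a_j$ and $1$ by $I_m$; $\operatorname{dom}_m r\subseteq M_m(\mathbb F)^g$ is the set of $\underline a$ at which all inverses occurring in $r$ exist; $\operatorname{dom}r=\bigcup_m\operatorname{dom}_mr$. $r$ is nondegenerate if $\operatorname{dom}r\ne\emptyset$. Nondegenerate $r_1,r_2$ are equivalent if $r_1(\underline a)=r_2(\underline a)$ for all $\underline a\in\operatorname{dom}r_1\cap\operatorname{dom}r_2$; noncommutative rational functions are the equivalence classes. $\operatorname{dom}_m\mathbbm r$ is the union of $\operatorname{dom}_mr$ over all representatives $r$ of $\mathbbm r$. Series: for $\mathcal A=M_m(\mathbb F)$ and freely noncommuting letters $\underline x=\{x_1,\dots,x_g\}$, $\mathcal A\langle\underline x\rangle=\mathcal A*_{\mathbb F}\mathbb F\langle\underline x\rangle$ and $\mathcal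 A\langle\!\langle\underline x\rangle\!\rangle$ is its $(\underline x)$-adic completion. For a word $w=w_1\cdots w_\ell$, $\mathcal A^w$ is the $\mathbb F$-span of all $a_0w_1a_1\cdots w_\ell a_\ell$, $a_i\in\mathcal A$; every series is uniquely $S=\sum_w[S,w]$ with $[S,w]\in\mathcal A^w$. A linear representation of dimension $n$ of $S$ is $(\mathbf c,A,\mathbf b)$ with $\mathbf c\in\mathcal A^{1\times n}$, $\mathbf b\in\mathcal A^{n\times1}$, $A^x\in(\mathcal A^x)^{n\times n}$ and $[S,w]=\mathbf cA^w\mathbf b$ for all words $w$, where $A^w=A^{w_1}\cdots A^{w_{|w|}}$. The zero series (only) has a representation of dimension $0$. Realizations: for $\underline p\in\operatorname{dom}_m\mathbbm r$, a realization of $\mathbbm r$ of dimension $n$ about $\underline p$ is a linear representation of dimension $n$ over $\mathcal A=M_m(\mathbb F)$ of the expansion $r(x_1+p_1,\dots,x_g+p_g)\in\mathcal A\langle\!\langle\underline x\rangle\!\rangle$, where $r$ is any representative of $\mathbbm r$ defined at $\underline p$ (the expansion does not depend on $r$). It is minimal if its dimension is the smallest among all realizations of $\mathbbm r$ about $\underline p$. *)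

(* Defs.v *)
From HB Require Import structures.
From mathcomp Require Import all_boot all_order all_algebra.
From mathcomp Require Import boolp functions.

Set Implicit Arguments.
Unset Strict Implicit.
Unset Printing Implicit Defensive.

Import GRing.Theory.
Local Open Scope ring_scope.

(* Formal power series in freely noncommuting letters Y with coefficients in  *)
(* an F-algebra K, where the letters commute with the coefficients.           *)
Definition ncseries (F : fieldType) (K : algType F) (Y : Type) : Type :=
  seq Y -> K.

Section NCSeries.
Variables (F : fieldType) (K : algType F) (Y : Type).
Local Notation ncs := (ncseries K Y).
Implicit Types S T U : ncs.

HB.instance Definition _ := GRing.Lmodule.copy ncs (seq Y -> K).

Definition ncs_const (a : K) : ncs := fun w => if w is [::] then a else 0.

Definition ncs_mul S T : ncs :=
  fun w => \sum_(i < (size w).+1) S (take i w) * T (drop i w).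

Definition ncs_shift (y : Y) S : ncs := fun w => S (y :: w).

Lemma ncs_addE S T w : (S + T) w = S w + T w.
Proof. by []. Qed.

Lemma ncs_mul_nil S T : ncs_mul S T [::] = S [::] * T [::].
Proof. by rewrite /ncs_mul big_ord1. Qed.

Lemma ncs_mul_cons S T y w :
  ncs_mul S T (y :: w) = S [::] * T (y :: w) + ncs_mul (ncs_shift y S) T w.
Proof. by rewrite /ncs_mul big_ord_recl. Qed.

Fact ncs_mulDl : left_distributive ncs_mul +%R.
Proof.
move=> S T U; apply/funext => w; rewrite ncs_addE /ncs_mul -big_split /=.
by apply: eq_bigr => i _; rewrite -mulrDl.
Qed.

Fact ncs_mulDr : right_distributive ncs_mul +%R.
Proof.
move=> S T U; apply/funext => w; rewrite ncs_addE /ncs_mul -big_split /=.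
by apply: eq_bigr => i _; rewrite -mulrDr.
Qed.

Fact ncs_mulA : associative ncs_mul.
Proof.
move=> S T U; apply/funext => w; elim: w S T => [|y w IHw] S T.
  by rewrite !ncs_mul_nil mulrA.
rewrite !ncs_mul_cons IHw ncs_mul_nil mulrDr mulrA -addrA; congr (_ + _).
set C := ncs_shift y (ncs_mul S T).
have -> : C = (fun w => S [::] * ncs_shift y T w) + ncs_mul (ncs_shift y S) T.
  by apply/funext => v; rewrite /C /ncs_shift ncs_mul_cons.
rewrite ncs_mulDl; congr (_ + _).
rewrite /ncs_mul mulr_sumr; apply: eq_bigr => i _.
by rewrite mulrA.
Qed.

Fact ncs_mul1l : left_id (ncs_const 1) ncs_mul.
Proof.
move=> S; apply/funext => w; rewrite /ncs_mul big_ord_recl /= take0 drop0 mul1r.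
rewrite big1 ?addr0 // => i _; case: w i => [|y w] i //=; first by case: i.
by rewrite mul0r.
Qed.

Fact ncs_mul1r : right_id (ncs_const 1) ncs_mul.
Proof.
move=> S; apply/funext => w; rewrite /ncs_mul big_ord_recr /=.
rewrite take_size drop_size mulr1 big1 ?add0r // => i _.
case E: (drop i w) => [|y v] /=; last by rewrite mulr0.
by move: (ltn_ord i); rewrite -subn_gt0 -size_drop E.
Qed.

Fact ncs_const1_neq0 : ncs_const 1 != 0 :> ncs.
Proof.
apply/eqP => /(congr1 (fun S : ncs => S [::])) /= /eqP.
by rewrite (oner_eq0 K).
Qed.

HB.instance Definition _ := GRing.Zmodule_isNzRing.Build ncs
  ncs_mulA ncs_mul1l ncs_mul1r ncs_mulDl ncs_mulDr ncs_const1_neq0.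

Fact ncs_scaleAl (c : F) S T : c *: (S * T) = (c *: S) * T.
Proof.
apply/funext => w; rewrite /GRing.mul /=.
change (c *: ncs_mul S T w = ncs_mul (c *: S) T w).
rewrite /ncs_mul scaler_sumr; apply: eq_bigr => i _.
by rewrite scalerAl.
Qed.

HB.instance Definition _ := GRing.Lmodule_isLalgebra.Build F ncs ncs_scaleAl.

Fact ncs_scaleAr (c : F) S T : c *: (S * T) = S * (c *: T).
Proof.
apply/funext => w; rewrite /GRing.mul /=.
change (c *: ncs_mul S T w = ncs_mul S (c *: T) w).
rewrite /ncs_mul scaler_sumr; apply: eq_bigr => i _.
by rewrite scalerAr.
Qed.

HB.instance Definition _ := GRing.Lalgebra_isAlgebra.Build F ncs ncs_scaleAr.

Definition ncs_inverse S : pred ncs := fun T => (T * S == 1) && (S * T == 1).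
Definition ncs_unit : pred ncs := fun S => `[< exists T, ncs_inverse S T >].
Definition ncs_inv S : ncs :=
  if pselect (exists T, ncs_inverse S T) is left h then xchoose h else S.

Fact ncs_mulVr : {in ncs_unit, left_inverse 1 ncs_inv *%R}.
Proof.
move=> S /asboolP SU; rewrite /ncs_inv; case: pselect => // h.
by case/andP: (xchooseP h) => /eqP.
Qed.

Fact ncs_mulrV : {in ncs_unit, right_inverse 1 ncs_inv *%R}.
Proof.
move=> S /asboolP SU; rewrite /ncs_inv; case: pselect => // h.
by case/andP: (xchooseP h) => _ /eqP.
Qed.

Fact ncs_unitP S T : T * S = 1 /\ S * T = 1 -> ncs_unit S.
Proof.
by case=> TS ST; apply/asboolP; exists T; rewrite /ncs_inverse TS ST eqxx.
Qed.

Fact ncs_inv_out : {in [predC ncs_unit], ncs_inv =1 id}.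
Proof.
move=> S; rewrite inE /= => /negP SU; rewrite /ncs_inv; case: pselect => // h.
by case: SU; apply/asboolP.
Qed.

HB.instance Definition _ := GRing.NzRing_hasMulInverse.Build ncs
  ncs_mulVr ncs_mulrV ncs_unitP ncs_inv_out.

End NCSeries.

Section RationalExpressions.
Variables (F : fieldType) (g : nat).

Inductive rexpr : Type :=
  | RConst of F
  | RVar of 'I_g
  | RAdd of rexpr & rexpr
  | RMul of rexpr & rexpr
  | RInv of rexpr.

(* Evaluation makes sense in any unital F-algebra; it is used both at tuples  *)
(* of matrices and at tuples of series.                                       *)
Fixpoint reval (B : unitAlgType F) (a : 'I_g -> B) (r : rexpr) : B :=
  match r with
  | RConst c => c%:A
  | RVar j => a j
  | RAdd r1 r2 => reval a r1 + reval a r2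
  | RMul r1 r2 => reval a r1 * reval a r2
  | RInv r1 => (reval a r1)^-1
  end.

Fixpoint rdefined (B : unitAlgType F) (a : 'I_g -> B) (r : rexpr) : bool :=
  match r with
  | RConst _ | RVar _ => true
  | RAdd r1 r2 | RMul r1 r2 => rdefined a r1 && rdefined a r2
  | RInv r1 => rdefined a r1 && (reval a r1 \is a GRing.unit)
  end.

(* The index m stands for matrices of size m + 1, so that sizes are positive. *)
Definition point (m : nat) : Type := 'I_g -> 'M[F]_m.+1.

Definition rnondegenerate (r : rexpr) : Prop :=
  exists (m : nat) (a : point m), rdefined a r.

Definition requiv (r1 r2 : rexpr) : Prop :=
  forall (m : nat) (a : point m),
    rdefined a r1 -> rdefined a r2 -> reval a r1 = reval a r2.

(* A noncommutative rational function is an equivalence class of              *)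
(* nondegenerate expressions, given as the set of its representatives.        *)
Record ncratfun : Type := NCRatFun {
  represents : rexpr -> Prop;
  representsP : exists2 r, rnondegenerate r &
    forall s, represents s <-> rnondegenerate s /\ requiv r s
}.

Definition rfdom (R : ncratfun) (m : nat) (p : point m) : Prop :=
  exists2 r, represents R r & rdefined p r.

End RationalExpressions.

(* Let A = M_(m+1)(F). As an F-vector space, A^w for w = w_1 ... w_l has the  *)
(* basis  E_{i0,j0} w_1 E_{i1,j1} w_2 ... w_l E_{il,jl}  made of matrix units *)
(* and letters. A series S in A<<x>> is stored as the function sending the    *)
(* word (j0,w_1,i1) (j1,w_2,i2) ... (j_(l-1),w_l,il) to the matrix whose      *)
(* entry at (i0,jl) is the coefficient of S at that basis element (see        *)
(* gmon_delta below). Since E_{i,j} E_{k,l} = 0 unless j = k, in which case   *)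
(* it is E_{i,l}, the product of A<<x>> becomes the product of ncseries: the  *)
(* regrouped letters (j,w,i) commute with A, the letters w themselves do not. *)
Definition gletter (g m : nat) : Type := ('I_m.+1 * 'I_g * 'I_m.+1)%type.
Definition gseries (F : fieldType) (g m : nat) : Type :=
  ncseries 'M[F]_m.+1 (gletter g m).
HB.instance Definition _ (F : fieldType) (g m : nat) :=
  GRing.UnitAlgebra.copy (gseries F g m) (ncseries 'M[F]_m.+1 (gletter g m)).

Section GeneralizedSeries.
Variables (F : fieldType) (g m : nat).
Local Notation A := 'M[F]_m.+1.
Local Notation ser := (gseries F g m).

Definition gconst (a : A) : ser := ncs_const a.

(* x = \sum_(j, i) E_{j,j} x E_{i,i} *)
Definition gvar (x : 'I_g) : ser := fun v : seq (gletter g m) =>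
  if v is [:: (j, y, i)] then if y == x then delta_mx j i else 0 else 0.

(* a_0 w_1 a_1 ... w_l a_l, for u = [:: (w_1, a_1); ...; (w_l, a_l)] *)
Definition gmon (a0 : A) (u : seq ('I_g * A)) : ser :=
  gconst a0 * \prod_(v <- u) (gvar v.1 * gconst v.2).

(* Membership in A^w; the scalars of a linear combination go into the a_0's. *)
Definition in_Aword (w : seq 'I_g) (S : ser) : Prop :=
  exists2 s : seq (A * seq ('I_g * A)),
    all (fun t => unzip1 t.2 == w) s & S = \sum_(t <- s) gmon t.1 t.2.

Definition gword (v : seq (gletter g m)) : seq 'I_g := [seq y.1.2 | y <- v].

(* [S, w] *)
Definition gcomp (S : ser) (w : seq 'I_g) : ser := fun v : seq (gletter g m) =>
  if gword v == w then S v else 0.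

(* E_{i0,j0} w_1 E_{i1,j1} ... w_l E_{il,jl} in the regrouped form, for       *)
(* u = [:: (w_1, (i1, j1)); ...; (w_l, (il, jl))].                            *)
Fixpoint regroup (j0 : 'I_m.+1) (u : seq ('I_g * ('I_m.+1 * 'I_m.+1))) :
    seq (gletter g m) * 'I_m.+1 :=
  if u is (x, (i, j)) :: u' then
    ((j0, x, i) :: (regroup j u').1, (regroup j u').2)
  else ([::], j0).

Lemma gmul_nil (S T : ser) : (S * T) [::] = S [::] * T [::].
Proof. exact: ncs_mul_nil. Qed.

Lemma gmul_cons (S T : ser) y v :
  (S * T) (y :: v) = S [::] * T (y :: v) + ((ncs_shift y S : ser) * T) v.
Proof. exact: ncs_mul_cons. Qed.

Lemma gconst_mul a (T : ser) v : (gconst a * T) v = a * T v.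
Proof.
case: v => [|y v]; rewrite ?gmul_nil // gmul_cons.
have -> : (ncs_shift y (gconst a) : ser) = 0 by apply/funext.
by rewrite mul0r [X in _ + X]/(0 : A) addr0.
Qed.

Lemma gvar_mul_nil x (T : ser) : (gvar x * T) [::] = 0.
Proof. by rewrite gmul_nil mul0r. Qed.

Lemma gvar_mul_cons x (T : ser) y v :
  (gvar x * T) (y :: v) =
    if y.1.2 == x then delta_mx y.1.1 y.2 * T v else 0.
Proof.
rewrite gmul_cons mul0r add0r; case: y => [[j z] i] /=.
have -> : (ncs_shift (j, z, i) (gvar x) : ser) =
    gconst (if z == x then delta_mx j i else 0).
  by apply/funext => -[|y u].
by rewrite gconst_mul; case: eqP => // _; rewrite mul0r.
Qed.

Lemma gmon_cons a0 x a u :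
  gmon a0 ((x, a) :: u) = gconst a0 * (gvar x * gmon a u).
Proof. by rewrite /gmon big_cons /= !mulrA. Qed.

Lemma delta_mulE (i j k l : 'I_m.+1) :
  delta_mx i j * delta_mx k l = delta_mx i l *+ (j == k) :> A.
Proof. exact: mul_delta_mx_cond. Qed.

Lemma gmon_delta i0 j0 (u : seq ('I_g * ('I_m.+1 * 'I_m.+1))) v :
  gmon (delta_mx i0 j0) [seq (t.1, delta_mx t.2.1 t.2.2) | t <- u] v =
    if v == (regroup j0 u).1 then delta_mx i0 (regroup j0 u).2 else 0.
Proof.
elim: u i0 j0 v => [|[x [i j]] u IHu] i0 j0 v /=.
  by rewrite /gmon big_nil mulr1; case: v.
rewrite gmon_cons gconst_mul; case: v => [|[[k y] l] v].
  by rewrite gvar_mul_nil mulr0.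
rewrite gvar_mul_cons /= IHu eqseq_cons !xpair_eqE.
case: (y =P x) => [_|_]; last by rewrite mulr0 andbF.
case: (v =P _) => [_|_]; last by rewrite andbF !mulr0.
rewrite !andbT delta_mulE; case: (l =P i) => [_|_]; last first.
  by rewrite mulr0n mulr0 andbF.
by rewrite mulr1n delta_mulE andbT eq_sym; case: eqP.
Qed.

Lemma gmon_out a u v : gword v != unzip1 u -> gmon a u v = 0.
Proof.
elim: u a v => [|[x b] u IHu] a [|y v] //=.
- by rewrite /gmon big_nil mulr1.
- by rewrite gmon_cons gconst_mul gvar_mul_nil mulr0.
rewrite eqseq_cons gmon_cons gconst_mul gvar_mul_cons.
case: eqP => _ /= vu; last by rewrite mulr0.
by rewrite (IHu _ _ vu) !mulr0.
Qed.

Lemma gsumE (I : Type) (r : seq I) (S : I -> ser) v :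
  (\sum_(i <- r) S i) v = \sum_(i <- r) S i v.
Proof. by elim/big_rec2: _ => // i _ T _ <-. Qed.

Lemma in_Aword_sum w (I : Type) (r : seq I) (S : I -> ser) :
  (forall i, in_Aword w (S i)) -> in_Aword w (\sum_(i <- r) S i).
Proof.
move=> wS; elim: r => [|i r [s ws IHr]].
  by exists [::]; rewrite // !big_nil.
have [t wt Si] := wS i; exists (t ++ s); first by rewrite all_cat wt.
by rewrite big_cons big_cat Si IHr.
Qed.

Lemma in_Aword_cons a x b w (S : ser) :
  in_Aword w S -> in_Aword (x :: w) (gconst a * (gvar x * (gconst b * S))).
Proof.
move=> [s ws ->]; exists [seq (a, (x, b * t.1) :: t.2) | t <- s].
  by rewrite all_map; apply: sub_all ws => t /= /eqP ->.
rewrite big_map !mulr_sumr; apply: eq_bigr => t _.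
rewrite gmon_cons /gmon [gconst b * _]mulrA; congr (_ * (_ * (_ * _))).
by apply/funext => v; rewrite gconst_mul; case: v => // *; rewrite mulr0.
Qed.

Lemma in_AwordP w (S : ser) :
  in_Aword w S <-> forall v, gword v != w -> S v = 0.
Proof.
split=> [[s ws ->] v vw|].
  rewrite gsumE; elim: s ws => [|t s IHs] /=; first by rewrite big_nil.
  by case/andP=> /eqP wt /IHs; rewrite big_cons gmon_out ?wt // add0r.
elim: w S => [|x w IHw] S S0.
  exists [:: (S [::], [::])] => //; rewrite big_seq1 /gmon big_nil mulr1.
  by apply/funext => -[|y v] //; rewrite S0.
pose T (j i : 'I_m.+1) : ser := ncs_shift (j, x, i) S.
have wT j i : in_Aword w (T j i).
  by apply: IHw => v vw; apply: S0; rewrite /= eqseq_cons eqxx.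
suff -> : S = \sum_j \sum_i \sum_k
    gconst (delta_mx k j) * (gvar x * (gconst (delta_mx i k) * T j i)).
  by do 3![apply: in_Aword_sum => ?]; apply: in_Aword_cons.
apply/funext => -[|[[j y] i] v].
  rewrite S0 // gsumE big1 // => j _; rewrite gsumE big1 // => i _.
  by rewrite gsumE big1 // => k _; rewrite gconst_mul gvar_mul_nil mulr0.
rewrite gsumE (bigD1 j) //= gsumE (bigD1 i) //= gsumE.
rewrite [X in _ + X + _]big1 ?addr0 => [|i' ii'].
  rewrite [X in _ + X]big1 ?addr0 => [|j' jj'].
    case: (y =P x) => [->|/eqP yx].
      rewrite (eq_bigr (fun k => (delta_mx k k : A) * T j i v)) => [|k _].
        rewrite -mulr_suml -[LHS]mul1r; congr (_ * _).
        apply/matrixP => k l; rewrite summxE (bigD1 k) //= !mxE eqxx /=.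
        rewrite big1 ?addr0 1?eq_sym // => h hk.
        by rewrite mxE eq_sym (negPf hk).
      rewrite gconst_mul gvar_mul_cons /= eqxx gconst_mul !mulrA.
      by rewrite !delta_mulE !eqxx !mulr1n delta_mulE eqxx.
    rewrite S0 => [|/=]; last by rewrite eqseq_cons negb_and yx.
    rewrite big1 // => k _.
    by rewrite gconst_mul gvar_mul_cons /= (negPf yx) mulr0.
  rewrite gsumE big1 // => i' _; rewrite gsumE big1 // => k _.
  rewrite gconst_mul gvar_mul_cons; case: eqP; rewrite ?mulr0 //= => _.
  by rewrite mulrA delta_mulE (negPf jj') mul0r.
rewrite gsumE big1 // => k _.
rewrite gconst_mul gvar_mul_cons; case: eqP; rewrite ?mulr0 //= => _.
rewrite gconst_mul mulrA mulrA delta_mulE eqxx mulr1n delta_mulE eq_sym.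
by rewrite (negPf ii') mul0r.
Qed.

End GeneralizedSeries.

Section Realizations.
Variables (F : fieldType) (g m : nat).

Record linrep (n : nat) : Type := LinRep {
  lr_c : 'rV['M[F]_m.+1]_n;
  lr_A : 'I_g -> 'M[gseries F g m]_n;
  lr_b : 'cV['M[F]_m.+1]_n
}.

Definition lr_pow (n : nat) (L : linrep n) (w : seq 'I_g) :
    'M[gseries F g m]_n :=
  \big[mulmx/1%:M]_(x <- w) lr_A L x.

Definition represents_series (n : nat) (L : linrep n) (S : gseries F g m) :
    Prop :=
  (forall x i j, in_Aword [:: x] (lr_A L x i j)) /\
  (forall w, gcomp S w =
     (map_mx (@gconst F g m) (lr_c L) *m lr_pow L w
        *m map_mx (@gconst F g m) (lr_b L)) ord0 ord0).

(* r(x_1 + p_1, ..., x_g + p_g) *)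
Definition expansion (p : point F g m) (r : rexpr F g) : gseries F g m :=
  reval (fun j => @gvar F g m j + @gconst F g m (p j)) r.

(* The expansion is the same for all representatives defined at p. *)
Definition realization (R : ncratfun F g) (p : point F g m) (n : nat)
    (L : linrep n) : Prop :=
  exists r, [/\ represents R r, rdefined p r &
                represents_series L (expansion p r)].

Definition minimal_realization (R : ncratfun F g) (p : point F g m) (n : nat)
    (L : linrep n) : Prop :=
  realization R p L /\
  forall (n' : nat) (L' : linrep n'), realization R p L' -> (n <= n')%N.

End Realizations.

(* Main.v *)
Require Import Defs.
From HB Require Import structures.
From mathcomp Require Import all_boot all_order all_algebra.
From mathcomp Require Import zify boolp.
From mathcomp.real_closed Require Import mxtens.

Set Implicit Arguments.
Unset Strict Implicit.
Unset Printing Implicit Defensive.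

Import GRing.Theory.
Local Open Scope ring_scope.

(** Write A for the algebra of (m+1) x (m+1) matrices. Sorting the letters
    of a series over A into the matrix-unit letters (j, x, i) turns a linear
    representation of dimension n into an ordinary realization over F of an
    A-valued series, with a state space of dimension n (m+1). Hence the
    minimal dimension about p is governed by Kalman's criterion: a realization
    that is reachable and observable has the least possible state space
    ([leq_state_dim]).

    A rational expression r is linearized once and for all: r = c L^-1 b with
    L an affine matrix pencil with coefficients in F, and L is invertible
    wherever r is defined, over every F-algebra ([linearization]). Expanding
    this at p yields a realization with state space F^e (x) F^(m+1), e being
    the size of L ([linearizes_expansion]).

    The heart of the proof is that this pencil can be made reachable and
    observable at all points of all sizes at the same time. If it is not
    observable at one point p, the span of the rows that are observed there is
    stable under A, hence of the form U (x) F^(m+1) with U a proper subspace of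
    F^e; the same holds for its translate by L(p)^-1. These two subspaces of
    F^e, which no longer refer to p, cut out a smaller pencil over F that
    represents the same function at every point ([shrink_unobservable]).
    Reachability follows by transposition, and by induction on e a pencil of
    some size d is both reachable and observable at every point of the domain
    of r ([reduced_pencil]). Then d is the minimal dimension at each of these
    points, whatever their size ([minimal_dim_of_expr]).

    There remains to compare two representatives r1 and r2, which may be
    known to be defined only at points of different sizes. Amplifying a
    point of each to the product of the two sizes and moving along the
    line that joins them gives, as F is infinite, a point where both are
    defined ([common_point]). There r1 and r2 have the same expansion,
    because the coefficients of a series can be read off from its values
    at block triangular matrices ([expansion_equiv]). So their minimal
    dimensions agree. *)

(** * Realizations over a field and Kalman's criterion *)

Section Words.
Variables (F : fieldType) (Y : Type).

Definition word_mx h (M : Y -> 'M[F]_h) (v : seq Y) : 'M[F]_h :=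
  \big[mulmx/1%:M]_(y <- v) M y.

Lemma word_mx_nil h (M : Y -> 'M[F]_h) : word_mx M [::] = 1%:M.
Proof. exact: big_nil. Qed.

Lemma word_mx_cons h (M : Y -> 'M[F]_h) y v :
  word_mx M (y :: v) = M y *m word_mx M v.
Proof. exact: big_cons. Qed.

Lemma word_mx_cat h (M : Y -> 'M[F]_h) u v :
  word_mx M (u ++ v) = word_mx M u *m word_mx M v.
Proof.
elim: u => [|y u IHu]; first by rewrite word_mx_nil mul1mx.
by rewrite cat_cons !word_mx_cons IHu mulmxA.
Qed.

Lemma word_mx_rcons h (M : Y -> 'M[F]_h) y v :
  word_mx M (rcons v y) = word_mx M v *m M y.
Proof. by rewrite -cats1 word_mx_cat word_mx_cons word_mx_nil mulmx1. Qed.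

Lemma word_mx_intertwine h h' (M : Y -> 'M[F]_h) (M' : Y -> 'M[F]_h')
    (T : 'M_(h', h)) v :
  (forall y, T *m M y = M' y *m T) -> T *m word_mx M v = word_mx M' v *m T.
Proof.
move=> TM; elim: v => [|y v IHv]; first by rewrite !word_mx_nil mulmx1 mul1mx.
by rewrite !word_mx_cons mulmxA TM -!mulmxA IHv.
Qed.

Lemma word_mx_ext h (M M' : Y -> 'M[F]_h) v :
  M =1 M' -> word_mx M v = word_mx M' v.
Proof. by move=> MM'; apply: eq_bigr => y _; apply: MM'. Qed.

Lemma word_mx_tr h (M : Y -> 'M[F]_h) v :
  (word_mx M v)^T = word_mx (fun y => (M y)^T) (rev v).
Proof.
elim: v => [|y v IHv]; first by rewrite !word_mx_nil trmx1.
by rewrite word_mx_cons trmx_mul IHv rev_cons word_mx_rcons.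
Qed.

Lemma word_mx_shift h (A : 'M[F]_h) (M : Y -> 'M[F]_h) v :
  A *m word_mx (fun y => M y *m A) v = word_mx (fun y => A *m M y) v *m A.
Proof. by apply: word_mx_intertwine => y; rewrite mulmxA. Qed.

(** The span of the observed rows, presented by square matrices so that it is
    the whole state space exactly when the identity is one of them. *)
Definition row_combination k h (C : 'M[F]_(k, h)) (M : Y -> 'M[F]_h)
    (G : 'M[F]_h) : Prop :=
  exists s : seq ('M[F]_(h, k) * seq Y),
    G = \sum_(t <- s) t.1 *m (C *m word_mx M t.2).

Definition observable k h (C : 'M[F]_(k, h)) (M : Y -> 'M[F]_h) : Prop :=
  row_combination C M 1%:M.

Definition reachable h l (M : Y -> 'M[F]_h) (B : 'M[F]_(h, l)) : Prop :=
  exists s : seq ('M[F]_(l, h) * seq Y),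
    \sum_(t <- s) word_mx M t.2 *m B *m t.1 = 1%:M.

Lemma row_combination0 k h (C : 'M[F]_(k, h)) M : row_combination C M 0.
Proof. by exists [::]; rewrite big_nil. Qed.

Lemma row_combinationD k h (C : 'M[F]_(k, h)) M G1 G2 :
  row_combination C M G1 -> row_combination C M G2 ->
  row_combination C M (G1 + G2).
Proof. by case=> [s1 ->] [s2 ->]; exists (s1 ++ s2); rewrite big_cat. Qed.

Lemma row_combinationMl k h (C : 'M[F]_(k, h)) M A G :
  row_combination C M G -> row_combination C M (A *m G).
Proof.
case=> [s ->]; exists [seq (A *m t.1, t.2) | t <- s].
by rewrite big_map mulmx_sumr; apply: eq_bigr => t _; rewrite !mulmxA.
Qed.

Lemma row_combinationMr k h (C : 'M[F]_(k, h)) M y G :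
  row_combination C M G -> row_combination C M (G *m M y).
Proof.
case=> [s ->]; exists [seq (t.1, rcons t.2 y) | t <- s].
rewrite big_map mulmx_suml; apply: eq_bigr => t _.
by rewrite word_mx_rcons !mulmxA.
Qed.

Lemma row_combination_word k h (C : 'M[F]_(k, h)) M A v :
  row_combination C M (A *m (C *m word_mx M v)).
Proof. by exists [:: (A, v)]; rewrite big_seq1. Qed.

(** The span of all rows of the C M^v is found without iterating: it is the
    row space of a combination of maximal rank, since the sum of two
    combinations with their spaces joined is again one. *)
Lemma row_combination_max k h (C : 'M[F]_(k, h)) M :
  exists G, [/\ row_combination C M G, (C <= G)%MS &
                forall y, (G *m M y <= G)%MS].
Proof.
pose P n := `[< exists2 G, row_combination C M G & \rank G = n >].
have exP : exists n, P n.
  exists 0; apply/asboolP; exists 0; rewrite ?mxrank0 //.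
  exact: row_combination0.
have ubP n : P n -> (n <= h)%N.
  by case/asboolP=> G _ <-; apply: rank_leq_row.
case: (ex_maxnP exP ubP) => _ /asboolP[G cG <-] Gmax.
have subG G' : row_combination C M G' -> (G' <= G)%MS.
  move=> cG'; have : (G + G' <= G + G')%MS by [].
  case/sub_addsmxP => -[A A'] /= defS.
  have cS : row_combination C M (G + G')%MS.
    by rewrite defS; apply: row_combinationD; apply: row_combinationMl.
  have /Gmax rS : P (\rank (G + G')%MS) by apply/asboolP; exists (G + G')%MS.
  have /andP[_] : (G == G + G')%MS.
    by rewrite -(geq_leqif (mxrank_leqif_eq (addsmxSl G G'))).
  exact: submx_trans (addsmxSr _ _).
exists G; split=> // [|y]; last by apply/subG/row_combinationMr.
have /submxP[A defC] : (<<C>> <= C)%MS by rewrite genmxE.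
have := subG _ (row_combination_word C M A [::]).
by rewrite word_mx_nil mulmx1 -defC genmxE.
Qed.

(** Expressing the identity both through rows C M^u and through columns M^v B
    makes it a combination of coefficients C M^(uv) B. Replacing these by the
    coefficients of the other realization factors the identity of size h
    through h'. *)
Lemma leq_state_dim k l h h' (C : 'M[F]_(k, h)) (M : Y -> 'M[F]_h)
    (B : 'M[F]_(h, l)) (C' : 'M[F]_(k, h')) (M' : Y -> 'M[F]_h')
    (B' : 'M[F]_(h', l)) :
  observable C M -> reachable M B ->
  (forall v, C *m word_mx M v *m B = C' *m word_mx M' v *m B') -> (h <= h')%N.
Proof.
move=> [s defs] [t deft] CMB.
have : (1%:M : 'M[F]_h) =
    (\sum_(a <- s) a.1 *m (C' *m word_mx M' a.2)) *m
    (\sum_(a <- t) word_mx M' a.2 *m B' *m a.1).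
  rewrite -{1}[1%:M]mulmx1 -{2}deft defs !mulmx_suml; apply: eq_bigr => a _.
  rewrite !mulmx_sumr; apply: eq_bigr => b _.
  have := CMB (a.2 ++ b.2); rewrite !word_mx_cat !mulmxA => eqab.
  by rewrite -!(mulmxA a.1) !mulmxA -!(mulmxA a.1) eqab.
move=> eq1; rewrite -[h](mxrank1 F) eq1.
by apply: leq_trans (mxrankM_maxl _ _) (rank_leq_col _).
Qed.

End Words.

Lemma word_mx_map (F : fieldType) (Y Y' : Type) h (f : Y -> Y')
    (M : Y' -> 'M[F]_h) v :
  word_mx M (map f v) = word_mx (M \o f) v.
Proof. exact: big_map. Qed.



(** * Submodules of a tensor product *)

Section Tensor.
Variable F : fieldType.

Lemma tensmxDr k l p q (A : 'M[F]_(k, l)) (B C : 'M_(p, q)) :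
  A *t (B + C) = A *t B + A *t C.
Proof. by apply/matrixP => i j; rewrite !mxE mulrDr. Qed.

Lemma tensmxZr k l p q (A : 'M[F]_(k, l)) (B : 'M_(p, q)) s :
  A *t (s *: B) = s *: (A *t B).
Proof. by apply/matrixP => i j; rewrite !mxE mulrCA. Qed.

Lemma tensmx_sumr k l p q (A : 'M[F]_(k, l)) I (r : seq I)
    (B : I -> 'M_(p, q)) :
  A *t (\sum_(i <- r) B i) = \sum_(i <- r) A *t B i.
Proof.
elim/big_rec2: _ => [|i S T _ <-]; first exact: tensmx0.
exact: tensmxDr.
Qed.

Lemma tens1mx1 k l : (1%:M : 'M[F]_k) *t (1%:M : 'M[F]_l) = 1%:M.
Proof.
apply/matrixP => i j; case: (mxtens_indexP i) => a b.
case: (mxtens_indexP j) => c d; rewrite tensmxE !mxE -natrM mulnb.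
by rewrite (can_eq (@mxtens_indexK _ _)) xpair_eqE.
Qed.

Lemma row_free_tens k l m (T : 'M[F]_(k, l)) :
  row_free T -> row_free (T *t (1%:M : 'M_m)).
Proof.
case/row_freeP => U TU; apply/row_freeP; exists (U *t 1%:M).
by rewrite tensmx_mul TU mulmx1 tens1mx1.
Qed.

(** The embedding of F^k into F^k (x) F^m given by the j-th basis vector of
    F^m; its transpose extracts the j-th component. *)
Definition tens_slot k m (j : 'I_m) : 'M[F]_(k, k * m) :=
  \matrix_(a, b) (b == mxtens_index (a, j))%:R.

Lemma tens_slot_mul k l m (T : 'M[F]_(k, l)) (j : 'I_m) :
  T *m tens_slot l j = tens_slot k j *m (T *t (1%:M : 'M_m)).
Proof.
apply/matrixP => a b; case: (mxtens_indexP b) => c d; rewrite !mxE.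
rewrite (bigD1 c) //= (bigD1 (mxtens_index (a, j))) //= !mxE.
rewrite !mxtens_indexK /= eqxx mul1r !(can_eq (@mxtens_indexK _ _)) /=.
rewrite !xpair_eqE eqxx /= eq_sym.
rewrite big1 => [|h hc]; last first.
  rewrite mxE (can_eq (@mxtens_indexK _ _)) xpair_eqE eq_sym (negPf hc).
  by rewrite mulr0.
by rewrite big1 // => h hc; rewrite mxE (negPf hc) mul0r.
Qed.

Lemma tens_slotK k m (j : 'I_m) :
  tens_slot k j *m (tens_slot k j)^T = 1%:M.
Proof.
apply/matrixP => a b; rewrite !mxE (bigD1 (mxtens_index (a, j))) //= !mxE eqxx.
rewrite (can_eq (@mxtens_indexK _ _)) xpair_eqE eqxx andbT mul1r.
by rewrite big1 ?addr0 // => h hc; rewrite !mxE (negPf hc) mul0r.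
Qed.

Lemma tens_slot_delta k m (i j : 'I_m) :
  (tens_slot k i)^T *m tens_slot k j = 1%:M *t delta_mx i j.
Proof.
apply/matrixP => a b; case: (mxtens_indexP a) => a1 a2.
case: (mxtens_indexP b) => b1 b2; rewrite tensmxE !mxE (bigD1 a1) //= !mxE.
rewrite !(can_eq (@mxtens_indexK _ _)) !xpair_eqE eqxx /= [b1 == _]eq_sym.
rewrite big1 ?addr0 => [|h ha]; last first.
  rewrite !mxE (can_eq (@mxtens_indexK _ _)) xpair_eqE eq_sym (negPf ha).
  by rewrite mul0r.
by rewrite -!natrM !mulnb andbCA.
Qed.

(** A subspace of F^e (x) F^m that is stable under the matrices acting on
    the second factor is a module over a full matrix algebra, so it is
    T (x) F^m where T is spanned by all components of its elements. *)
Lemma tens_submodule k e m (G : 'M[F]_(k, e * m)) :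
  (forall i j, (G *m ((1%:M : 'M_e) *t (delta_mx i j : 'M_m)) <= G)%MS) ->
  exists e' (T : 'M[F]_(e', e)),
    row_free T /\ (T *t (1%:M : 'M_m) :=: G)%MS.
Proof.
move=> Gmod; pose slice j := G *m (tens_slot e j)^T.
pose S := (\sum_j <<slice j>>)%MS.
exists (\rank S), (row_base S); split; first exact: row_base_free.
apply/eqmxP/andP; split.
  apply/row_subP => a; case: (mxtens_indexP a) => b j.
  have -> : row (mxtens_index (b, j)) (row_base S *t (1%:M : 'M_m)) =
      row b (row_base S *m tens_slot e j).
    rewrite tens_slot_mul row_mul [LHS]rowE; congr (_ *m _).
    by apply/rowP => c; rewrite !mxE eqxx.
  apply: submx_trans (row_sub _ _) _.
  apply: (@submx_trans _ _ _ _ _ _ (S *m tens_slot e j)).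
    by rewrite submxMr ?eq_row_base.
  rewrite sumsmxMr_gen; apply/sumsmx_subP => i _; rewrite genmxE.
  rewrite (eqmxMr _ (genmxE (slice i))).
  by rewrite /slice -mulmxA tens_slot_delta.
have {1}-> : G = \sum_j slice j *m tens_slot e j.
  rewrite -[LHS]mulmx1 -tens1mx1 [X in _ *t X]matrix_sum_delta.
  rewrite tensmx_sumr mulmx_sumr; apply: eq_bigr => i _.
  rewrite (bigD1 i) //= big1 ?addr0 => [|j ji]; last first.
    by rewrite mxE eq_sym (negPf ji) scale0r.
  by rewrite mxE eqxx scale1r /slice -mulmxA tens_slot_delta.
apply: summx_sub => j _.
apply: (@submx_trans _ _ _ _ _ _ (row_base S *m tens_slot e j)).
  by rewrite submxMr // eq_row_base (sumsmx_sup j) ?genmxE.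
by rewrite tens_slot_mul submxMl.
Qed.

Lemma tensmx1_submx k l e m (A : 'M[F]_(k, e)) (B : 'M_(l, e)) :
  (A *t (1%:M : 'M_m.+1) <= B *t (1%:M : 'M_m.+1))%MS -> (A <= B)%MS.
Proof.
case/submxP => X AB; apply/submxP.
pose S n : 'M[F]_(n, n * m.+1) := tens_slot n ord0.
exists (S k *m X *m (S l)^T).
have SBS : (B *t 1%:M) *m (S e)^T = (S l)^T *m B.
  apply: trmx_inj; rewrite !trmx_mul !trmxK trmx_tens trmx1.
  by rewrite -tens_slot_mul.
rewrite -mulmxA -SBS -mulmxA [X *m _]mulmxA -AB mulmxA -tens_slot_mul.
by rewrite -mulmxA tens_slotK mulmx1.
Qed.

End Tensor.

(** * Pencils and their realizations about matrix points *)

Section Pencils.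
Variables (F : fieldType) (g : nat).

(** The expression c (L_0 - \sum_x L_x x)^-1 b, with c, L and b its three
    fields. The index None stands for the constant term L_0. *)
Record pencil (e : nat) : Type := Pencil {
  pencil_out : 'rV[F]_e;
  pencil_mx : option 'I_g -> 'M[F]_e;
  pencil_in : 'cV[F]_e
}.

Definition pencil_var (B : unitAlgType F) (a : 'I_g -> B) (o : option 'I_g) :
    B :=
  if o is Some x then - a x else 1.

Definition pencil_at e (P : pencil e) m (p : point F g m) :
    'M[F]_(e * m.+1) :=
  \sum_o pencil_mx P o *t pencil_var p o.

(** Put L = L(p). Expanding c (L - \sum_x L_x y_x)^-1 b in the matrix units
    (j, x, i) as a geometric series gives the realization with output c,
    transitions L^-1 (L_x (x) E_(j,i)) and input L^-1 b. *)
Definition pencil_C e (P : pencil e) m : 'M[F]_(1 * m.+1, e * m.+1) :=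
  pencil_out P *t 1%:M.

Definition pencil_M e (P : pencil e) m (p : point F g m) (y : gletter g m) :
    'M[F]_(e * m.+1) :=
  invmx (pencil_at P p) *m (pencil_mx P (Some y.1.2) *t delta_mx y.1.1 y.2).

Definition pencil_B e (P : pencil e) m (p : point F g m) :
    'M[F]_(e * m.+1, 1 * m.+1) :=
  invmx (pencil_at P p) *m (pencil_in P *t 1%:M).

Definition pencil_coef e (P : pencil e) m (p : point F g m)
    (v : seq (gletter g m)) : 'M[F]_(1 * m.+1) :=
  pencil_C P m *m word_mx (pencil_M P p) v *m pencil_B P p.

(** Only the points of D matter, and D mixes all matrix sizes: this lets a
    defect observed at one point be removed at all the others. *)
Definition shrinks_on (D : forall m, point F g m -> Prop) e (P : pencil e) :=
  exists e' (P' : pencil e'), (e' < e)%N /\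
    forall m (p : point F g m), D m p -> pencil_at P' p \in unitmx /\
      forall v, pencil_coef P' p v = pencil_coef P p v.

(** A sub-pencil, in the sense of a pair of subspaces T', T of the row space
    with T' L_o contained in T for all o, is automatically invertible wherever
    the pencil is: T' is injective, so T' L(p) = L'(p) T has full rank. *)
Lemma pencil_reduction e e'
    (P : pencil e) (P' : pencil e') (T T' : 'M[F]_(e', e)) :
  row_free T' ->
  pencil_out P = pencil_out P' *m T ->
  (forall o, T' *m pencil_mx P o = pencil_mx P' o *m T) ->
  pencil_in P' = T' *m pencil_in P ->
  forall m (p : point F g m), pencil_at P p \in unitmx ->
    pencil_at P' p \in unitmx /\
    forall v, pencil_coef P' p v = pencil_coef P p v.
Proof.
move=> freeT' outE mxE inE m p Pp.
pose tT := T *t (1%:M : 'M[F]_m.+1); pose tT' := T' *t (1%:M : 'M[F]_m.+1).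
have atE : tT' *m pencil_at P p = pencil_at P' p *m tT.
  rewrite /pencil_at mulmx_sumr mulmx_suml; apply: eq_bigr => o _.
  by rewrite !tensmx_mul mxE mul1mx mulmx1.
have P'p : pencil_at P' p \in unitmx.
  rewrite -row_free_unit -row_leq_rank.
  have rE : \rank (tT' *m pencil_at P p) = (e' * m.+1)%N.
    by rewrite mxrankMfree ?row_free_unit //; apply/eqP/row_free_tens.
  by apply: leq_trans (eq_leq (esym rE)) _; rewrite atE mxrankM_maxl.
split=> // v.
have invE : tT *m invmx (pencil_at P p) = invmx (pencil_at P' p) *m tT'.
  apply: (can_inj (mulmxK Pp)); rewrite mulmxKV // -mulmxA atE.
  by rewrite mulKmx.
have ME y : tT *m pencil_M P p y = pencil_M P' p y *m tT.
  rewrite /pencil_M mulmxA invE -!mulmxA; congr (_ *m _).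
  by rewrite !tensmx_mul mxE mul1mx mulmx1.
rewrite /pencil_coef.
have -> : pencil_C P m = pencil_C P' m *m tT.
  by rewrite /pencil_C tensmx_mul outE mulmx1.
have -> : pencil_B P' p = tT *m pencil_B P p.
  by rewrite /pencil_B mulmxA invE -mulmxA tensmx_mul inE mulmx1.
by rewrite -!(mulmxA (pencil_C P' m)) (word_mx_intertwine _ ME) !mulmxA.
Qed.

(** Let U be the span of the rows observed at p0. Both U and U L^-1, with L the
    value of the pencil at p0, are stable under 1 (x) a, so each comes from a
    subspace of F^e; the two have the same dimension and form a sub-pencil,
    which is valid at every point of D. *)
Lemma shrink_unobservable (D : forall m, point F g m -> Prop) e (P : pencil e)
    m0 (p0 : point F g m0) :
  (forall m p, D m p -> pencil_at P p \in unitmx) -> D m0 p0 ->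
  ~ observable (pencil_C P m0) (pencil_M P p0) -> shrinks_on D P.
Proof.
move=> PD Dp0 Nobs; have Pp0 := PD _ _ Dp0.
have [G [cG CG MG]] := row_combination_max (pencil_C P m0) (pencil_M P p0).
set L := pencil_at P p0 in Pp0.
have rG : (\rank G < e * m0.+1)%N.
  rewrite ltn_neqAle rank_leq_row andbT; apply/negP => freeG; apply: Nobs.
  have /row_freeP[H GH] : row_free G by [].
  rewrite /observable -(mulmx1C GH).
  exact: row_combinationMl.
(* Stability under the letters extends by linearity to all L_x (x) a. *)
have LG x (a : 'M_m0.+1) :
    (G *m (invmx L *m (pencil_mx P (Some x) *t a)) <= G)%MS.
  rewrite [a]matrix_sum_delta !(tensmx_sumr, mulmx_sumr).
  apply: summx_sub => j _.
  rewrite !(tensmx_sumr, mulmx_sumr); apply: summx_sub => i _.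
  by rewrite tensmxZr -!scalemxAr scalemx_sub // (MG (j, x, i)).
have Gmod a : (G *m ((1%:M : 'M_e) *t (a : 'M_m0.+1)) <= G)%MS.
  have [s defG] := cG; rewrite {1}defG mulmx_suml summx_sub // => -[A v] _ /=.
  rewrite -mulmxA mulmx_sub //.
  case/lastP: v => [|v y].
    rewrite word_mx_nil mulmx1 tensmx_mul mulmx1 mul1mx.
    rewrite (_ : _ *t a = ((1%:M : 'M_1) *t a) *m pencil_C P m0).
      by rewrite mulmx_sub.
    by rewrite tensmx_mul mul1mx mulmx1.
  rewrite word_mx_rcons -!mulmxA tensmx_mul mulmx1.
  rewrite mulmxA; apply: submx_trans (LG y.1.2 (delta_mx y.1.1 y.2 *m a)).
  apply: submxMr; elim/last_ind: v => [|v z IHv].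
    by rewrite word_mx_nil mulmx1.
  by rewrite word_mx_rcons mulmxA (submx_trans (submxMr _ IHv)).
have [e1 [T [freeT TG]]] := tens_submodule (fun i j => Gmod (delta_mx i j)).
(* U L^-1 is stable because 1 (x) a commutes with the term L_0 (x) 1 of L, so
   that (1 (x) a) L and L (1 (x) a) differ by terms L_x (x) a' only. *)
have G'mod i j :
    (G *m invmx L *m ((1%:M : 'M_e) *t (delta_mx i j : 'M_m0.+1))
      <= G *m invmx L)%MS.
  set a := delta_mx i j.
  rewrite -[X in (X <= _)%MS](mulmxK Pp0) submxMr //.
  have LE : (1%:M *t a) *m L = \sum_o pencil_mx P o *t (a *m pencil_var p0 o).
    by rewrite /L mulmx_sumr; apply: eq_bigr => o _; rewrite tensmx_mul mul1mx.
  have LE' : L *m (1%:M *t a) = \sum_o pencil_mx P o *t (pencil_var p0 o *m a).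
    by rewrite /L mulmx_suml; apply: eq_bigr => o _; rewrite tensmx_mul mulmx1.
  rewrite -(mulmxA (G *m invmx L)) LE.
  have -> : \sum_o pencil_mx P o *t (a *m pencil_var p0 o) =
      L *m (1%:M *t a) +
      \sum_o pencil_mx P o *t (a *m pencil_var p0 o - pencil_var p0 o *m a).
    rewrite LE' -big_split /=; apply: eq_bigr => o _.
    by rewrite -tensmxDr addrC subrK.
  rewrite mulmxDr mulmxA mulmxKV // addmx_sub //.
  rewrite mulmx_sumr summx_sub // => -[x|] _; last first.
    by rewrite /= mulmx1 mul1mx subrr tensmx0 mulmx0 sub0mx.
  by rewrite -mulmxA LG.
have [e2 [T' [freeT' TG']]] := tens_submodule G'mod.
have e12 : e1 = e2.
  have : (e1 * m0.+1 = e2 * m0.+1)%N.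
    rewrite -(eqP (row_free_tens m0.+1 freeT)).
    rewrite -(eqP (row_free_tens m0.+1 freeT')).
    by rewrite TG TG' mxrankMfree // row_free_unit unitmx_inv.
  by move/eqP; rewrite eqn_pmul2r // => /eqP.
case: _ / e12 in T' freeT' TG' *.
(* For the constant term, L_0 (x) 1 is L plus terms L_x (x) a. *)
have mxP o : exists N : 'M[F]_e1, T' *m pencil_mx P o = N *m T.
  apply/submxP; apply: (@tensmx1_submx _ _ _ _ m0).
  rewrite TG -[1%:M]mulmx1 -tensmx_mul (eqmxMr _ TG') -mulmxA.
  case: o => [x|]; first exact: LG.
  have -> : pencil_mx P None *t 1%:M =
      L + \sum_(o | o != None) pencil_mx P o *t - pencil_var p0 o.
    rewrite /L /pencil_at (bigD1 None) //= -addrA -big_split /=.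
    rewrite big1 ?addr0 // => o _.
    by rewrite -tensmxDr subrr tensmx0.
  rewrite mulmxDr mulVmx // mulmxDr mulmx1 addmx_sub //.
  rewrite !mulmx_sumr summx_sub // => -[x|] // _; exact: LG.
have /submxP[c cE] : (pencil_out P <= T)%MS.
  by apply: (@tensmx1_submx _ _ _ _ m0); rewrite TG.
have [N NE] := choice mxP.
pose P1 := Pencil c N (T' *m pencil_in P); exists e1, P1; split.
  rewrite -(ltn_pmul2r (ltn0Sn m0)) -(eqP (row_free_tens m0.+1 freeT)).
  by rewrite TG.
move=> m p /PD.
exact: (@pencil_reduction _ _ P P1 T T' freeT' cE NE erefl).
Qed.

End Pencils.

(** * Transposition, and pencils minimal at all points at once *)

Section Duality.
Variables (F : fieldType) (g : nat).

Definition tr_pencil e (P : pencil F g e) : pencil F g e :=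
  Pencil (pencil_in P)^T (fun o => (pencil_mx P o)^T) (pencil_out P)^T.

Definition tr_point m (p : point F g m) : point F g m := fun x => (p x)^T.

Definition tr_letter m (y : gletter g m) : gletter g m := (y.2, y.1.2, y.1.1).

Lemma tr_pointK m (p : point F g m) : tr_point (tr_point p) = p.
Proof. by apply/funext => x; rewrite /tr_point trmxK. Qed.

Lemma tr_pencilK e (P : pencil F g e) : tr_pencil (tr_pencil P) = P.
Proof.
case: P => c L b; rewrite /tr_pencil /= !trmxK; congr Pencil.
by apply/funext => o; rewrite trmxK.
Qed.

Lemma tr_letterK m : involutive (@tr_letter m).
Proof. by case=> [[]]. Qed.

Lemma pencil_at_tr e (P : pencil F g e) m (p : point F g m) :
  pencil_at (tr_pencil P) (tr_point p) = (pencil_at P p)^T.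
Proof.
rewrite /pencil_at raddf_sum; apply: eq_bigr => -[x|] _ /=.
  by rewrite trmx_tens [in RHS]linearN.
by rewrite trmx_tens trmx1.
Qed.

Lemma pencil_M_tr e (P : pencil F g e) m (p : point F g m) y :
  pencil_M (tr_pencil P) (tr_point p) (tr_letter y) =
  (invmx (pencil_at P p))^T *m
  (pencil_mx P (Some y.1.2) *t delta_mx y.1.1 y.2)^T.
Proof. by rewrite /pencil_M pencil_at_tr trmx_inv trmx_tens trmx_delta. Qed.

(** The factors L^-1 sit on the left of each transition; transposition moves
    them to the right, and the extra L^-1 at the end restores the pattern. *)
Lemma word_mx_tr_pencil e (P : pencil F g e) m (p : point F g m) v :
  (word_mx (pencil_M P p) v *m invmx (pencil_at P p))^T =
  word_mx (pencil_M (tr_pencil P) (tr_point p)) (map (@tr_letter m) (rev v)) *m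
  (invmx (pencil_at P p))^T.
Proof.
rewrite word_mx_map (word_mx_ext _ (pencil_M_tr P p)) -word_mx_shift.
rewrite trmx_mul word_mx_tr; congr (_ *m _); apply: word_mx_ext => y.
by rewrite trmx_mul.
Qed.

Lemma pencil_coef_tr e (P : pencil F g e) m (p : point F g m) v :
  pencil_coef (tr_pencil P) (tr_point p) (map (@tr_letter m) (rev v)) =
  (pencil_coef P p v)^T.
Proof.
rewrite /pencil_coef -[in RHS]mulmxA [X in _ *m X]/pencil_B.
rewrite (mulmxA (word_mx _ v)) (trmx_mul (pencil_C P m)).
rewrite (trmx_mul (_ *m invmx _)) word_mx_tr_pencil /pencil_B pencil_at_tr.
by rewrite trmx_inv /pencil_C !trmx_tens trmx1 -!mulmxA.
Qed.

Lemma mulmx_sum2 I (s : seq I) k h l h' (A : 'M[F]_(k, h)) (B : 'M[F]_(l, h'))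
    (X : I -> 'M[F]_(h, l)) :
  A *m (\sum_(i <- s) X i) *m B = \sum_(i <- s) A *m X i *m B.
Proof. by rewrite mulmx_sumr mulmx_suml. Qed.

Lemma shrink_unreachable (D : forall m, point F g m -> Prop) e
    (P : pencil F g e) m0 (p0 : point F g m0) :
  (forall m p, D m p -> pencil_at P p \in unitmx) -> D m0 p0 ->
  ~ reachable (pencil_M P p0) (pencil_B P p0) -> shrinks_on D P.
Proof.
move=> PD Dp0 Nreach.
pose D' m (p : point F g m) := D m (tr_point p).
have P'D' m (p : point F g m) : D' m p -> pencil_at (tr_pencil P) p \in unitmx.
  by move=> /PD; rewrite -(tr_pointK p) pencil_at_tr unitmx_tr tr_pointK.
have [|obs|e' [Q [lte Qgood]]] := shrink_unobservable P'D' (p0 := tr_point p0).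
- by rewrite /D' tr_pointK.
- apply: Nreach; have [s /(congr1 trmx)] := obs.
  set L := pencil_at P p0; have Lunit : L \in unitmx := PD _ _ Dp0.
  rewrite trmx1 raddf_sum /= => eq1.
  exists [seq (t.1^T *m L, map (@tr_letter m0) (rev t.2)) | t <- s].
  have <- : invmx L *m 1%:M *m L = 1%:M by rewrite mulmx1 mulVmx.
  rewrite eq1 big_map mulmx_sum2.
  apply: eq_bigr => -[A v] _ /=; rewrite trmx_mul !mulmxA; congr (_ *m _ *m _).
  apply: trmx_inj.
  set w := map _ (rev v); have -> : v = map (@tr_letter m0) (rev w).
    by rewrite /w -map_rev revK (mapK (@tr_letterK m0)).
  rewrite trmx_mul word_mx_tr_pencil !trmx_mul !trmxK.
  by rewrite /pencil_C /= trmx_tens trmx1 mulmxA.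
exists e', (tr_pencil Q); split=> // m p Dp.
have D'p : D' m (tr_point p) by rewrite /D' tr_pointK.
have [Qp Qcoef] := Qgood _ _ D'p; split.
  by rewrite -(tr_pointK p) pencil_at_tr unitmx_tr.
move=> v; set w := map (@tr_letter m) (rev v).
have -> : v = map (@tr_letter m) (rev w).
  by rewrite /w -map_rev revK (mapK (@tr_letterK m)).
rewrite -{1}(tr_pointK p) pencil_coef_tr Qcoef -pencil_coef_tr.
by rewrite tr_pointK tr_pencilK.
Qed.

(** Each defect of observability or reachability lowers the size, and a pencil
    that can no longer shrink has neither, at any point of D. *)
Lemma reduced_pencil (D : forall m, point F g m -> Prop) e (P : pencil F g e) :
  (forall m p, D m p -> pencil_at P p \in unitmx) ->
  exists e' (P' : pencil F g e'), forall m (p : point F g m), D m p ->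
    [/\ pencil_at P' p \in unitmx,
        observable (pencil_C P' m) (pencil_M P' p),
        reachable (pencil_M P' p) (pencil_B P' p) &
        forall v, pencil_coef P' p v = pencil_coef P p v].
Proof.
elim/ltn_ind: e P => e IHe P PD.
have [[e' [P' [lte P'D]]]|Nshrink] := pselect (shrinks_on D P).
  have P'D1 m p : D m p -> pencil_at P' p \in unitmx by case/P'D.
  have [e1 [P1 P1D]] := IHe _ lte P' P'D1.
  exists e1, P1 => m p Dp; have [? ? ? P1coef] := P1D _ _ Dp.
  by split=> // v; rewrite P1coef; have [_] := P'D _ _ Dp.
exists e, P => m p Dp; split=> //; first exact: PD.
  by apply: contrapT => /(shrink_unobservable PD Dp).
by apply: contrapT => /(shrink_unreachable PD Dp).
Qed.

End Duality.

(** * Linearization of rational expressions *)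

Section Linearization.
Variables (F : fieldType) (g : nat).

Section Eval.
Variables (B : unitAlgType F) (a : 'I_g -> B).

Definition affine_eval k l (L : option 'I_g -> 'M[F]_(k, l)) : 'M[B]_(k, l) :=
  \matrix_(i, j) \sum_o L o i j *: pencil_var a o.

Lemma affine_eval_block k1 k2 l1 l2 (L : option 'I_g -> 'M[F]_(k1, l1))
    (L12 : option 'I_g -> 'M[F]_(k1, l2)) (L21 : option 'I_g -> 'M[F]_(k2, l1))
    (L22 : option 'I_g -> 'M[F]_(k2, l2)) :
  affine_eval (fun o => block_mx (L o) (L12 o) (L21 o) (L22 o)) =
  block_mx (affine_eval L) (affine_eval L12)
    (affine_eval L21) (affine_eval L22).
Proof.
apply/matrixP => i j; rewrite -[i]splitK -[j]splitK.
case: (split i) => i'; case: (split j) => j'; rewrite mxE;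
  under eq_bigr => o _ do
    rewrite ?block_mxEul ?block_mxEur ?block_mxEdl ?block_mxEdr;
  by rewrite ?block_mxEul ?block_mxEur ?block_mxEdl ?block_mxEdr mxE.
Qed.

Definition affine_const k l (M : 'M[F]_(k, l)) (o : option 'I_g) :
    'M[F]_(k, l) :=
  if o is None then M else 0.

Lemma affine_eval_const k l (M : 'M[F]_(k, l)) :
  affine_eval (affine_const M) = map_mx (in_alg B) M.
Proof.
apply/matrixP => i j; rewrite !mxE (bigD1 None) //= big1 ?addr0 // => -[x|] //.
by rewrite /= mxE scale0r.
Qed.

Lemma affine_eval0 k l : affine_eval (fun _ => (0 : 'M_(k, l))) = 0.
Proof.
by apply/matrixP => i j; rewrite !mxE big1 // => o _; rewrite ?mxE scale0r.
Qed.

End Eval.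

(** The algebra B varies so that the same pencil serves both at matrix points
    and at tuples of series. *)
Definition linearizes e (P : pencil F g e) (r : rexpr F g) : Prop :=
  forall (B : unitAlgType F) (a : 'I_g -> B), rdefined a r ->
  exists X : 'M[B]_e,
    [/\ affine_eval a (pencil_mx P) *m X = 1%:M,
        X *m affine_eval a (pencil_mx P) = 1%:M &
        map_mx (in_alg B) (pencil_out P) *m X *m
          map_mx (in_alg B) (pencil_in P) = (reval a r)%:M].

Lemma linearization_const c :
  exists e (P : pencil F g e), linearizes P (RConst g c).
Proof.
exists 1, (Pencil c%:M (affine_const 1%:M) 1%:M) => B a _; exists 1%:M.
rewrite affine_eval_const /= !map_mx1 !mulmx1; split=> //.
by rewrite map_scalar_mx.
Qed.

Lemma linearization_var x :
  exists e (P : pencil F g e), linearizes P (RVar F x).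
Proof.
pose L o : 'M[F]_(1 + 1) := block_mx (affine_const 1%:M o)
  (if o == Some x then 1%:M else 0) 0 (affine_const 1%:M o).
exists (1 + 1)%N, (Pencil (row_mx 1%:M 0) L (col_mx 0 1%:M)) => B a _.
have evL : affine_eval a L = block_mx 1%:M (- (a x)%:M) 0 1%:M.
  rewrite affine_eval_block affine_eval_const map_mx1 affine_eval0.
  congr block_mx.
  apply/matrixP => i j; rewrite !mxE (bigD1 (Some x)) //= eqxx !ord1 mxE eqxx.
  by rewrite scale1r big1 ?addr0 ?mulr1n // => o /negPf ->; rewrite mxE scale0r.
exists (block_mx 1%:M (a x)%:M 0 1%:M); rewrite evL /=; split.
- by rewrite mulmx_block !(mulmx0, mul0mx, mulmx1, mul1mx, addr0, add0r) subrr
    -scalar_mx_block.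
- by rewrite mulmx_block !(mulmx0, mul0mx, mulmx1, mul1mx, addr0, add0r) addNr
    -scalar_mx_block.
rewrite map_row_mx map_col_mx !map_mx1 !raddf0 mul_row_block mul_row_col.
by rewrite !(mulmx0, mul0mx, mulmx1, mul1mx, addr0, add0r).
Qed.

Lemma linearization_add e1 e2 (P1 : pencil F g e1) (P2 : pencil F g e2) r1 r2 :
  linearizes P1 r1 -> linearizes P2 r2 ->
  exists e (P : pencil F g e), linearizes P (RAdd r1 r2).
Proof.
move=> P1r1 P2r2.
pose L o := block_mx (pencil_mx P1 o) 0 0 (pencil_mx P2 o).
exists (e1 + e2)%N, (Pencil (row_mx (pencil_out P1) (pencil_out P2)) L
  (col_mx (pencil_in P1) (pencil_in P2))) => B a /= /andP[a1 a2].
have [X1 [LX1 XL1 r1E]] := P1r1 B a a1; have [X2 [LX2 XL2 r2E]] := P2r2 B a a2.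
exists (block_mx X1 0 0 X2); rewrite affine_eval_block !affine_eval0; split.
- by rewrite mulmx_block !(mulmx0, mul0mx, addr0, add0r)
    LX1 LX2 -scalar_mx_block.
- by rewrite mulmx_block !(mulmx0, mul0mx, addr0, add0r)
    XL1 XL2 -scalar_mx_block.
rewrite map_row_mx map_col_mx mul_row_block mul_row_col.
by rewrite !(mulmx0, mul0mx, addr0, add0r) r1E r2E raddfD.
Qed.

(** The inverse of [[L1, - b1 c2], [0, L2]] has X1 b1 c2 X2 as its upper right
    block, where X1 and X2 are the inverses of L1 and L2. *)
Lemma linearization_mul e1 e2 (P1 : pencil F g e1) (P2 : pencil F g e2) r1 r2 :
  linearizes P1 r1 -> linearizes P2 r2 ->
  exists e (P : pencil F g e), linearizes P (RMul r1 r2).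
Proof.
move=> P1r1 P2r2.
pose N := - (pencil_in P1 *m pencil_out P2).
pose L o := block_mx (pencil_mx P1 o) (affine_const N o) 0 (pencil_mx P2 o).
exists (e1 + e2)%N, (Pencil (row_mx (pencil_out P1) 0) L
  (col_mx 0 (pencil_in P2))) => B a /= /andP[a1 a2].
have [X1 [LX1 XL1 r1E]] := P1r1 B a a1; have [X2 [LX2 XL2 r2E]] := P2r2 B a a2.
rewrite affine_eval_block affine_eval_const !affine_eval0.
rewrite /N map_mxN map_mxM /=.
set b1 := map_mx _ (pencil_in P1); set c2 := map_mx _ (pencil_out P2).
exists (block_mx X1 (X1 *m b1 *m c2 *m X2) 0 X2); split.
- rewrite mulmx_block !(mulmx0, mul0mx, addr0, add0r) LX1 LX2.
  rewrite !mulmxA LX1 mul1mx.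
  by rewrite mulNmx subrr -scalar_mx_block.
- rewrite mulmx_block !(mulmx0, mul0mx, addr0, add0r) XL1 XL2.
  rewrite -!mulmxA XL2 mulmx1.
  by rewrite mulmxN addNr -scalar_mx_block.
rewrite map_row_mx map_col_mx !raddf0 mul_row_block mul_row_col.
rewrite !(mulmx0, mul0mx, addr0, add0r) !mulmxA r1E -!mulmxA (mulmxA c2) r2E.
by rewrite -scalar_mxM.
Qed.

(** The bordered matrix [[L1, b1], [c1, 0]] has Schur complement
    - c1 L1^-1 b1, which is minus the value of r1, so that the lower right
    entry of its inverse is minus the value of RInv r1. *)
Lemma linearization_inv e1 (P1 : pencil F g e1) r1 :
  linearizes P1 r1 -> exists e (P : pencil F g e), linearizes P (RInv r1).
Proof.
move=> P1r1.
pose L o := block_mx (pencil_mx P1 o) (affine_const (pencil_in P1) o)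
  (affine_const (pencil_out P1) o) 0.
exists (e1 + 1)%N, (Pencil (row_mx 0 (- 1%:M)) L (col_mx 0 1%:M))
  => B a /= /andP[a1 ua].
have [X1 [LX1 XL1 r1E]] := P1r1 B a a1.
rewrite affine_eval_block !affine_eval_const !affine_eval0.
set b := map_mx _ (pencil_in P1) in r1E *.
set c := map_mx _ (pencil_out P1) in r1E *.
set s := reval a r1 in r1E ua *.
have ss : s%:M *m (s^-1)%:M = 1%:M :> 'M_1 by rewrite -scalar_mxM divrr.
have ss' : (s^-1)%:M *m s%:M = 1%:M :> 'M_1 by rewrite -scalar_mxM mulVr.
exists (block_mx (X1 - X1 *m b *m s^-1%:M *m c *m X1) (X1 *m b *m s^-1%:M)
   (s^-1%:M *m c *m X1) (- s^-1%:M)); split.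
- rewrite mulmx_block !(mulmx0, mul0mx, addr0, add0r).
  rewrite !mulmxBr !mulmxA LX1 mul1mx.
  rewrite subrK r1E mulmxN subrr ss mul1mx subrr.
  by rewrite -scalar_mx_block.
- rewrite mulmx_block !(mulmx0, mul0mx, addr0, add0r).
  rewrite !mulmxBl -!mulmxA XL1 mulmx1.
  rewrite subrK mulNmx subrr (mulmxA c) r1E ss' !mulmx1 subrr.
  by rewrite -scalar_mx_block.
rewrite map_row_mx map_col_mx !raddf0 map_mxN !map_mx1.
rewrite mul_row_block mul_row_col.
by rewrite !(mulmx0, mul0mx, mulmx1, mul1mx, mulNmx, addr0, add0r) opprK.
Qed.

Lemma linearization r : exists e (P : pencil F g e), linearizes P r.
Proof.
elim: r => [c|x|r1 [e1 [P1 IH1]] r2 [e2 [P2 IH2]]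
  |r1 [e1 [P1 IH1]] r2 [e2 [P2 IH2]]|r1 [e1 [P1 IH1]]].
- exact: linearization_const.
- exact: linearization_var.
- exact: linearization_add IH1 IH2.
- exact: linearization_mul IH1 IH2.
- exact: linearization_inv IH1.
Qed.

End Linearization.

(** * Coefficients of the expansion of an expression *)

Section SeriesUnits.
Variables (F : fieldType) (g m : nat).
Local Notation A := 'M[F]_m.+1.
Local Notation ser := (gseries F g m).
Implicit Types (S T : ser) (w : seq (gletter g m)).

Lemma gmulE S T w :
  (S * T) w = \sum_(i < (size w).+1) S (take i w) * T (drop i w).
Proof. by []. Qed.

Lemma gaddE S T w : (S + T) w = S w + T w. Proof. by []. Qed.
Lemma goppE S w : (- S) w = - S w. Proof. by []. Qed.
Lemma gscaleE c S w : (c *: S) w = c *: S w. Proof. by []. Qed.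
Lemma goneE w : (1 : ser) w = gconst 1 w. Proof. by []. Qed.

Lemma gmul_const S (a : A) w : (S * gconst a) w = S w * a.
Proof.
rewrite gmulE big_ord_recr /= take_size drop_size big1 ?add0r // => i _.
case E: (drop i w) => [|y v] /=; last by rewrite mulr0.
by move: (ltn_ord i); rewrite -subn_gt0 -size_drop E.
Qed.

Lemma gexp_small S n w : S [::] = 0 -> (size w < n)%N -> (S ^+ n) w = 0.
Proof.
move=> S0; elim: n w => // n IHn w ltwn; rewrite exprS gmulE.
rewrite big_ord_recl take0 S0 mul0r add0r big1 // => i _.
rewrite IHn ?mulr0 // size_drop /= /bump /= add1n.
by have := ltn_ord i; lia.
Qed.

(** Normalize S to 1 - N with N without constant term; the geometric series
    of N is locally finite. *)
Lemma gunit_right_inverse S : S [::] \is a GRing.unit -> exists T, S * T = 1.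
Proof.
move=> uS; pose a := (S [::])^-1; pose N := 1 - gconst a * S.
have N0 : N [::] = 0.
  by rewrite /N gaddE goppE gconst_mul mulVr // goneE /= subrr.
pose T : ser := fun w => (\sum_(n < (size w).+1) N ^+ n) w.
have TE k w : (size w < k)%N -> T w = (\sum_(n < k) N ^+ n) w.
  move=> /subnKC <-; rewrite big_split_ord /= gaddE /T.
  rewrite [X in _ + X]gsumE [X in _ + X]big1 ?addr0 // => i _.
  by rewrite gexp_small // leq_addr.
have NT : N * T = T - 1.
  apply/funext => w.
  have -> : (N * T) w = (N * \sum_(n < (size w).+1) N ^+ n) w.
    rewrite !gmulE; apply: eq_bigr => i _; congr (_ * _).
    by apply: TE; rewrite size_drop ltnS leq_subr.
  rewrite [RHS]gaddE goppE (TE (size w).+2) //.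
  rewrite [in RHS]big_ord_recl gaddE expr0 addrC addKr mulr_sumr; congr (_ w).
  by apply: eq_bigr => i _; rewrite exprS.
exists (T * gconst a).
have aST : gconst a * S * T = 1.
  by have := NT; rewrite /N mulrBl mul1r => /addrI/oppr_inj.
have aS : gconst (S [::]) * gconst a = 1 :> ser.
  apply/funext => w; rewrite gconst_mul.
  by case: w => [|y w] /=; rewrite ?divrr // mulr0.
rewrite mulrA -[S]mul1r -{1}aS -!mulrA (mulrA S) (mulrA (gconst a)).
by rewrite (mulrA _ S T) aST mul1r aS.
Qed.

(** A right inverse T of S again has an invertible constant term, so it has a
    right inverse itself, which must be S. *)
Lemma gunitP S : S [::] \is a GRing.unit -> S \is a GRing.unit.
Proof.
move=> uS; have [T ST] := gunit_right_inverse uS.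
have [|T' TT'] := @gunit_right_inverse T.
  have := congr1 (fun f : ser => f [::]) ST.
  rewrite /= gmul_nil goneE /= => ST0.
  by apply/unitrP; exists (S [::]); split=> //; apply: mulmx1C.
apply/unitrP; exists T; split=> //.
by rewrite -[S]mulr1 -TT' (mulrA S) ST mul1r.
Qed.

Definition expansion_point (p : point F g m) (j : 'I_g) : ser :=
  @gvar F g m j + gconst (p j).

Lemma expansion_defined (p : point F g m) r : rdefined p r ->
  rdefined (expansion_point p) r /\ expansion p r [::] = reval p r.
Proof.
elim: r => [c|x|r1 IH1 r2 IH2|r1 IH1 r2 IH2|r1 IH1] //=.
- by move=> _; split; rewrite // /expansion /= gaddE add0r.
- case/andP=> /IH1[d1 e1] /IH2[d2 e2]; split; first exact/andP.
  by rewrite -e1 -e2.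
- case/andP=> /IH1[d1 e1] /IH2[d2 e2]; split; first exact/andP.
  by rewrite -e1 -e2 -gmul_nil.
case/andP=> /IH1[d1 e1] u1.
have u : expansion p r1 \is a GRing.unit by apply: gunitP; rewrite e1.
split; first exact/andP.
have : (expansion p r1 * (expansion p r1)^-1) [::] = 1 by rewrite divrr.
by rewrite gmul_nil e1 => /(canRL (mulKr u1)); rewrite mulr1.
Qed.

End SeriesUnits.

Section Flatten.
Variables (F : fieldType) (m : nat).

Definition flatten_mx k l (A : 'M['M[F]_m.+1]_(k, l)) :
    'M[F]_(k * m.+1, l * m.+1) :=
  \matrix_(i, j) A (mxtens_unindex i).1 (mxtens_unindex j).1
                   (mxtens_unindex i).2 (mxtens_unindex j).2.

Lemma flatten_mxE k l (A : 'M['M[F]_m.+1]_(k, l)) i a j b :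
  flatten_mx A (mxtens_index (i, a)) (mxtens_index (j, b)) = A i j a b.
Proof. by rewrite mxE !mxtens_indexK. Qed.

Lemma flatten_mx_inj k l : injective (@flatten_mx k l).
Proof.
move=> A B AB; apply/matrixP => i j; apply/matrixP => a b.
by rewrite -!flatten_mxE AB.
Qed.

Lemma flatten_mxM k n l (A : 'M['M[F]_m.+1]_(k, n)) (B : 'M_(n, l)) :
  flatten_mx (A *m B) = flatten_mx A *m flatten_mx B.
Proof.
apply/matrixP => i j; case: (mxtens_indexP i) => a b.
case: (mxtens_indexP j) => c d; rewrite flatten_mxE !mxE summxE.
under eq_bigr => h _ do rewrite -mulmxE mxE.
rewrite pair_big /= (reindex (@mxtens_unindex n m.+1)) /=.
  by apply: eq_bigr => h _; rewrite !mxE !mxtens_indexK.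
exists (@mxtens_index n m.+1) => h _; first exact: mxtens_unindexK.
exact: mxtens_indexK.
Qed.

Lemma flatten_mxD k l (A B : 'M['M[F]_m.+1]_(k, l)) :
  flatten_mx (A + B) = flatten_mx A + flatten_mx B.
Proof. by apply/matrixP => i j; rewrite !mxE. Qed.

Definition unflatten_mx k l (M : 'M[F]_(k * m.+1, l * m.+1)) :
    'M['M[F]_m.+1]_(k, l) :=
  \matrix_(i, j) \matrix_(a, b) M (mxtens_index (i, a)) (mxtens_index (j, b)).

Lemma unflatten_mxK k l : cancel (@unflatten_mx k l) (@flatten_mx k l).
Proof.
move=> M; apply/matrixP => i j; case: (mxtens_indexP i) => a b.
by case: (mxtens_indexP j) => c d; rewrite flatten_mxE !mxE.
Qed.

Lemma flatten_mx1 k : flatten_mx (1%:M : 'M_k) = 1%:M.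
Proof.
apply/matrixP => i j; case: (mxtens_indexP i) => a b.
case: (mxtens_indexP j) => c d; rewrite flatten_mxE !mxE.
rewrite (can_eq (@mxtens_indexK _ _)) xpair_eqE.
by case: (a == c); rewrite /= ?mulr1n ?mulr0n !mxE.
Qed.

Lemma flatten_mx_in_alg k l (M : 'M[F]_(k, l)) :
  flatten_mx (map_mx (in_alg 'M[F]_m.+1) M) = M *t 1%:M.
Proof.
apply/matrixP => i j; case: (mxtens_indexP i) => a b.
by case: (mxtens_indexP j) => c d; rewrite flatten_mxE tensmxE !mxE.
Qed.

End Flatten.

Section ExpansionCoef.
Variables (F : fieldType) (g m : nat).
Local Notation ser := (gseries F g m).

Definition coef_mx k l (v : seq (gletter g m)) (A : 'M[ser]_(k, l)) :
    'M[F]_(k * m.+1, l * m.+1) :=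
  flatten_mx (map_mx (fun S : ser => S v) A).

Lemma coef_mxM_nil k n l (A : 'M[ser]_(k, n)) (B : 'M_(n, l)) :
  coef_mx [::] (A *m B) = coef_mx [::] A *m coef_mx [::] B.
Proof.
rewrite -flatten_mxM; congr flatten_mx; apply/matrixP => i j; rewrite !mxE.
by rewrite gsumE; apply: eq_bigr => h _; rewrite !mxE gmul_nil.
Qed.

Lemma coef_mxM_cons k n l (A : 'M[ser]_(k, n)) (B : 'M_(n, l)) y v :
  coef_mx (y :: v) (A *m B) = coef_mx [::] A *m coef_mx (y :: v) B +
    coef_mx v (map_mx (fun S : ser => ncs_shift y S : ser) A *m B).
Proof.
rewrite -flatten_mxM -flatten_mxD; congr flatten_mx.
apply/matrixP => i j; rewrite !mxE !gsumE -big_split.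
by apply: eq_bigr => h _; rewrite !mxE gmul_cons.
Qed.

Lemma coef_const_mxM k n l (A : 'M['M[F]_m.+1]_(k, n)) (B : 'M[ser]_(n, l)) v :
  coef_mx v (map_mx (@gconst F g m) A *m B) = flatten_mx A *m coef_mx v B.
Proof.
rewrite -flatten_mxM; congr flatten_mx; apply/matrixP => i j; rewrite !mxE.
by rewrite gsumE; apply: eq_bigr => h _; rewrite !mxE gconst_mul.
Qed.

Lemma coef_mxM_const k n l (A : 'M[ser]_(k, n)) (B : 'M['M[F]_m.+1]_(n, l)) v :
  coef_mx v (A *m map_mx (@gconst F g m) B) = coef_mx v A *m flatten_mx B.
Proof.
rewrite -flatten_mxM; congr flatten_mx; apply/matrixP => i j; rewrite !mxE.
by rewrite gsumE; apply: eq_bigr => h _; rewrite !mxE gmul_const.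
Qed.

Lemma map_in_alg_gconst k l (M : 'M[F]_(k, l)) :
  map_mx (in_alg ser) M = map_mx (@gconst F g m) (map_mx (in_alg 'M[F]_m.+1) M).
Proof.
apply/matrixP => i j; rewrite !mxE /=; apply/funext => -[|y v];
  by rewrite gscaleE //= scaler0.
Qed.

Lemma coef_mx1 n (v : seq (gletter g m)) :
  coef_mx v (1%:M : 'M[ser]_n) = if v is [::] then 1%:M else 0.
Proof.
case: v => [|y v].
  rewrite /coef_mx -flatten_mx1; congr flatten_mx; apply/matrixP => i j.
  by rewrite !mxE; case: eqP.
by apply/matrixP => i j; rewrite !mxE; case: (_ == _); rewrite /= mxE //.
Qed.

Lemma coef_pencil_nil e (P : pencil F g e) (p : point F g m) :
  coef_mx [::] (affine_eval (expansion_point p) (pencil_mx P)) = pencil_at P p.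
Proof.
apply/matrixP => i j; case: (mxtens_indexP i) => a b.
case: (mxtens_indexP j) => c d; rewrite flatten_mxE !mxE gsumE !summxE.
apply: eq_bigr => o _; rewrite tensmxE gscaleE mxE; congr (_ * _).
case: o => [x|] /=; last by rewrite mxE.
by rewrite goppE /expansion_point gaddE add0r.
Qed.

Lemma shift_pencil e (P : pencil F g e) (p : point F g m) y :
  map_mx (fun S : ser => ncs_shift y S : ser)
      (affine_eval (expansion_point p) (pencil_mx P)) =
  map_mx (@gconst F g m)
    (- \matrix_(i, j) (pencil_mx P (Some y.1.2) i j *: delta_mx y.1.1 y.2)).
Proof.
apply/matrixP => i j; rewrite !mxE; apply/funext => v.
rewrite /ncs_shift gsumE (bigD1 (Some y.1.2)) //= big1 ?addr0 => [|[x|] xy].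
- rewrite gscaleE goppE /expansion_point gaddE addr0; case: y => [[a x] b] /=.
  by case: v => [|z v] /=; rewrite ?eqxx ?scalerN // scaler0 oppr0.
- rewrite gscaleE /= goppE /expansion_point gaddE addr0.
  case: y xy => [[a z] b] /= xz.
  case: v => [|? ?] /=; last by rewrite oppr0 scaler0.
  have /negPf -> : z != x by apply: contra xz => /eqP ->.
  by rewrite oppr0 scaler0.
by rewrite gscaleE /= scaler0.
Qed.

(** The equation L X = 1 over series, taken coefficient by coefficient, says
    that X has constant term L(p)^-1 and that prefixing a letter to a word
    multiplies the coefficient of X by the corresponding transition. *)
Lemma linearizes_expansion e (P : pencil F g e) r (p : point F g m) :
  linearizes P r -> rdefined p r ->
  pencil_at P p \in unitmx /\
  forall v, flatten_mx (expansion p r v)%:M = pencil_coef P p v.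
Proof.
move=> Pr /expansion_defined[pr _]; have [X [LX _ cXb]] := Pr _ _ pr.
have X0 : pencil_at P p *m coef_mx [::] X = 1%:M.
  by rewrite -coef_pencil_nil -coef_mxM_nil LX coef_mx1.
have [Pp _] := mulmx1_unit X0; split=> // v.
have XE : coef_mx v X = word_mx (pencil_M P p) v *m invmx (pencil_at P p).
  elim: v => [|y v IHv].
    by rewrite word_mx_nil mul1mx -[LHS](mulKmx Pp) X0 mulmx1.
  have := congr1 (coef_mx (y :: v)) LX; rewrite coef_mxM_cons coef_mx1.
  rewrite coef_pencil_nil shift_pencil coef_const_mxM => /eqP.
  rewrite addr_eq0 => /eqP Xyv.
  rewrite -[LHS](mulKmx Pp) Xyv word_mx_cons -!mulmxA -IHv; congr (_ *m _).
  rewrite -mulNmx; congr (_ *m _); apply/matrixP => i j.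
  case: (mxtens_indexP i) => a b; case: (mxtens_indexP j) => c d.
  by rewrite mxE flatten_mxE tensmxE !mxE opprK.
rewrite /pencil_coef -mulmxA /pencil_B [word_mx _ v *m _]mulmxA -XE.
rewrite /pencil_C -!flatten_mx_in_alg -coef_mxM_const -coef_const_mxM.
rewrite -!map_in_alg_gconst mulmxA cXb; congr flatten_mx.
by apply/matrixP => i j; rewrite !mxE !ord1.
Qed.

End ExpansionCoef.

(** * Linear representations as realizations over the base field *)

Section Realizations.
Variables (F : fieldType) (g m : nat).
Local Notation ser := (gseries F g m).

Definition lr_M n (L : linrep F g m n) (y : gletter g m) : 'M[F]_(n * m.+1) :=
  flatten_mx (map_mx (fun S : ser => S [:: y]) (lr_A L y.1.2)).

Definition homogeneous n (L : linrep F g m n) : Prop :=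
  forall x i j, in_Aword [:: x] (lr_A L x i j).

Lemma lr_pow_coef n (L : linrep F g m n) w v : homogeneous L ->
  coef_mx v (lr_pow L w) = if gword v == w then word_mx (lr_M L) v else 0.
Proof.
move=> homL; elim: w v => [|x w IHw] v.
  rewrite /lr_pow big_nil coef_mx1; case: v => [|y v] //.
  by rewrite word_mx_nil.
have AE i j v' : gword v' != [:: x] -> lr_A L x i j v' = 0.
  by move: v'; apply/in_AwordP.
rewrite /lr_pow big_cons -/(lr_pow L w).
have A0 : coef_mx [::] (lr_A L x) = 0.
  by apply/matrixP => i j; rewrite !mxE AE // mxE.
case: v => [|y v]; first by rewrite coef_mxM_nil A0 mul0mx.
rewrite coef_mxM_cons A0 mul0mx add0r.
have -> : map_mx (fun S : ser => ncs_shift y S : ser) (lr_A L x) =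
    map_mx (@gconst F g m) (if y.1.2 == x then
      map_mx (fun S : ser => S [:: y]) (lr_A L y.1.2) else 0).
  apply/matrixP => i j; rewrite mxE [RHS]mxE; apply/funext => -[|z v'].
    rewrite /ncs_shift /=; case: eqP => [->|/eqP yx]; first by rewrite mxE.
    by rewrite mxE AE //= eqseq_cons (negPf yx).
  by rewrite /ncs_shift /= AE //= eqseq_cons andbF.
rewrite coef_const_mxM IHw /= eqseq_cons word_mx_cons.
case: eqP => [yx|_] /=; last first.
  rewrite (_ : flatten_mx 0 = 0) ?mul0mx //.
  by apply/matrixP => i j; rewrite !mxE.
by case: eqP => _; rewrite ?mulmx0.
Qed.

(** A representation of dimension n is the same as a realization over F with
    state space F^n (x) F^(m+1): since the entries of A^x are of degree one,
    only the factorization of a word into letters contributes. *)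
Lemma represents_seriesP n (L : linrep F g m n) (S : ser) : homogeneous L ->
  represents_series L S <->
  forall v, flatten_mx (S v)%:M =
    flatten_mx (lr_c L) *m word_mx (lr_M L) v *m flatten_mx (lr_b L).
Proof.
move=> homL.
have powE w v : flatten_mx ((map_mx (@gconst F g m) (lr_c L) *m lr_pow L w
        *m map_mx (@gconst F g m) (lr_b L)) ord0 ord0 v)%:M =
   if gword v == w then
     flatten_mx (lr_c L) *m word_mx (lr_M L) v *m flatten_mx (lr_b L) else 0.
  transitivity (coef_mx v (map_mx (@gconst F g m) (lr_c L) *m lr_pow L w
        *m map_mx (@gconst F g m) (lr_b L))).
    by congr flatten_mx; apply/matrixP => i j; rewrite !ord1 !mxE.
  rewrite coef_mxM_const coef_const_mxM lr_pow_coef //.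
  by case: ifP => _; rewrite ?mulmx0 ?mul0mx.
split=> [[_ SE] v|SE].
  by have := powE (gword v) v; rewrite -SE /gcomp eqxx.
split=> // w; apply/funext => v; rewrite /gcomp.
have inj11 (a b : 'M[F]_m.+1) :
    flatten_mx (a%:M : 'M_1) = flatten_mx b%:M -> a = b.
  by move/flatten_mx_inj/matrixP/(_ 0 0); rewrite !mxE.
apply: inj11; rewrite powE; case: eqP => // _.
by apply/matrixP => i j; rewrite !mxE !ord1 mxE.
Qed.

Lemma linrep_of_matrices n (C : 'M[F]_(1 * m.+1, n * m.+1))
    (M : gletter g m -> 'M[F]_(n * m.+1)) (B : 'M[F]_(n * m.+1, 1 * m.+1))
    (S : ser) :
  (forall v, flatten_mx (S v)%:M = C *m word_mx M v *m B) ->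
  exists L : linrep F g m n, represents_series L S.
Proof.
move=> SE.
pose A x : 'M[ser]_n := \matrix_(i, j) ((fun v =>
  if v is [:: y] then if y.1.2 == x then unflatten_mx (M y) i j else 0 else 0)
  : ser).
exists (LinRep (unflatten_mx C) A (unflatten_mx B)).
apply/represents_seriesP => [x i j|v].
  apply/in_AwordP => -[|y [|z v]]; rewrite mxE //= eqseq_cons andbT.
  by move/negPf ->.
rewrite SE /= !unflatten_mxK; congr (_ *m _ *m _); apply: word_mx_ext => y.
rewrite /lr_M /= -[LHS]unflatten_mxK; congr flatten_mx.
by apply/matrixP => i j; rewrite [RHS]mxE [in RHS]mxE eqxx.
Qed.

End Realizations.

(** Reachability and observability of one reduced pencil at every point make
    its size e optimal everywhere. Comparing state spaces gives
    e (m+1) <= n (m+1), whence the size m+1 of the point cancels. *)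
Lemma minimal_dim_of_expr (F : fieldType) g (r : rexpr F g) :
  exists e, forall m (p : point F g m), rdefined p r ->
    (exists L : linrep F g m e, represents_series L (expansion p r)) /\
    (forall n (L : linrep F g m n), represents_series L (expansion p r) ->
       (e <= n)%N).
Proof.
have [e0 [P0 P0r]] := linearization r.
have [|e [P Pr]] := @reduced_pencil F g (fun m p => rdefined p r) e0 P0.
  by move=> m p /(linearizes_expansion P0r)[].
exists e => m p pr; have [_ coefP0] := linearizes_expansion P0r pr.
have [Pp obs reach coefP] := Pr m p pr.
have rE v : flatten_mx (expansion p r v)%:M = pencil_coef P p v.
  by rewrite coefP0 coefP.
split=> [|n L Lr]; first exact: linrep_of_matrices rE.
have [homL _] := Lr; move/(represents_seriesP _ homL): Lr => rL.
rewrite -(leq_pmul2r (ltn0Sn m)); apply: (leq_state_dim obs reach) => v.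
exact: etrans (esym (rE v)) (rL v).
Qed.

(** * The expansion depends only on the rational function *)

Section Morphisms.
Variables (F : fieldType) (g : nat).

Lemma reval_morph (B B' : unitAlgType F) (f : {lrmorphism B -> B'})
    (a : 'I_g -> B) r : rdefined a r ->
  rdefined (f \o a) r /\ reval (f \o a) r = f (reval a r).
Proof.
elim: r => [c|x|r1 IH1 r2 IH2|r1 IH1 r2 IH2|r1 IH1] //=.
- by move=> _; rewrite rmorph_alg.
- by case/andP=> /IH1[-> ->] /IH2[-> ->]; rewrite rmorphD.
- by case/andP=> /IH1[-> ->] /IH2[-> ->]; rewrite rmorphM.
by case/andP=> /IH1[-> ->] u; rewrite rmorph_unit // rmorphV.
Qed.

Section Amplification.
Variables (m k : nat).
Local Notation N := (m.+1 * k.+1).-1.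

Definition amplify_right (a : 'M[F]_m.+1) : 'M[F]_N.+1 :=
  a *t (1%:M : 'M[F]_k.+1).

Definition amplify_left (a : 'M[F]_k.+1) : 'M[F]_N.+1 :=
  (1%:M : 'M[F]_m.+1) *t a.

Fact amplify_right_linear : linear amplify_right.
Proof.
move=> c a b; apply/matrixP => i j; rewrite !mxE.
by rewrite mulrDl mulrA.
Qed.

Fact amplify_right_monoid : monoid_morphism amplify_right.
Proof.
split=> [|a b]; first exact: (@tens1mx1 F m.+1 k.+1).
by have /esym := tensmx_mul a (1%:M : 'M_k.+1) b 1%:M; rewrite mulmx1.
Qed.

Fact amplify_left_linear : linear amplify_left.
Proof.
by move=> c a b; rewrite /amplify_left tensmxDr tensmxZr.
Qed.

Fact amplify_left_monoid : monoid_morphism amplify_left.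
Proof.
split=> [|a b]; first exact: (@tens1mx1 F m.+1 k.+1).
by have /esym := tensmx_mul (1%:M : 'M_m.+1) a 1%:M b; rewrite mulmx1.
Qed.

HB.instance Definition _ := GRing.isLinear.Build F _ _ _ amplify_right
  amplify_right_linear.
HB.instance Definition _ := GRing.isMonoidMorphism.Build _ _ amplify_right
  amplify_right_monoid.
HB.instance Definition _ := GRing.isLinear.Build F _ _ _ amplify_left
  amplify_left_linear.
HB.instance Definition _ := GRing.isMonoidMorphism.Build _ _ amplify_left
  amplify_left_monoid.

End Amplification.

Section Jets.
Variables (m : nat) (v : seq (gletter g m)).
Local Notation l := (size v).
Local Notation N := (l.+1 * m.+1).-1.

(** Block (i, j) is the coefficient of S at the factor of v between positions
    i and j. This is evaluation of S at strictly upper block triangular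
    matrices adapted to v, and its last block of the first row is the
    coefficient at v. *)
Definition jet_blocks (S : gseries F g m) : 'M['M[F]_m.+1]_l.+1 :=
  \matrix_(i, j) if (i <= j)%N then S (take (j - i) (drop i v)) else 0.

(** A factor of v splits at each intermediate position exactly once, which is
    how the coefficients of a product of series are computed. *)
Lemma jet_blocksM (S T : gseries F g m) :
  jet_blocks (S * T) = jet_blocks S *m jet_blocks T.
Proof.
apply/matrixP => i j; rewrite !mxE.
under [RHS]eq_bigr => h _ do rewrite !mxE.
pose G h := (if (i <= h)%N then S (take (h - i) (drop i v)) else 0) *
            (if (h <= j)%N then T (take (j - h) (drop h v)) else 0).
rewrite -(big_mkord xpredT G).
have [ij|ji] := leqP i j; last first.
  rewrite big1 // => h _; rewrite /G.
  case: leqP => [ih|_]; last by rewrite mul0r.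
  case: leqP => [hj|_]; last by rewrite mulr0.
  by have := leq_trans ih hj; rewrite leqNgt ji.
rewrite (big_cat_nat (n := i)) //=; last by rewrite ltnW.
rewrite big_nat big1 ?add0r => [|h /andP[_ hi]]; last first.
  by rewrite /G leqNgt hi mul0r.
rewrite (big_cat_nat (n := j.+1)) //=; last by rewrite ltnW.
rewrite [X in _ + X]big_nat [X in _ + X]big1 ?addr0 => [|h /andP[jh _]];
  last first.
  by rewrite /G [(h <= j)%N]leqNgt jh mulr0.
have szu : size (take (j - i) (drop i v)) = (j - i)%N.
  rewrite size_takel // size_drop leq_sub2r //.
  by have := ltn_ord j.
have -> : \sum_(i <= h < j.+1) G h = \sum_(h < (j - i).+1) G (h + i)%N.
  by rewrite -{1}[nat_of_ord i]add0n big_addn subSn // big_mkord.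
rewrite gmulE szu.
apply: eq_bigr => -[h /= hlt] _; rewrite /G leq_addl addnK.
have hj : (h + i <= j)%N by rewrite -(subnK ij) leq_add2r.
rewrite hj; congr (S _ * T _); last first.
  by rewrite !take_drop !subnK // drop_drop.
by rewrite take_takel // -ltnS.
Qed.

Definition jet (S : gseries F g m) : 'M[F]_N.+1 := flatten_mx (jet_blocks S).

Fact jet_linear : linear jet.
Proof.
move=> c S T; apply/matrixP => i j; rewrite !mxE.
by case: ifP => _; rewrite !mxE ?mulr0 ?addr0.
Qed.

Fact jet_monoid : monoid_morphism jet.
Proof.
split=> [|S T]; last by rewrite /jet jet_blocksM flatten_mxM.
apply: etrans (@flatten_mx1 F m l.+1); congr flatten_mx; apply/matrixP => i j.
rewrite !mxE goneE; have [ij|ji] := leqP i j; last first.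
  by rewrite -val_eqE /= gtn_eqF.
rewrite -val_eqE /= eqn_leq ij /= -subn_eq0.
case E: (take _ _) => [|y u] /=.
  have := congr1 size E; rewrite size_takel => [/= ->//|].
  by rewrite size_drop leq_sub2r // -ltnS ltn_ord.
by have := congr1 size E; case: (j - i)%N => //; rewrite take0.
Qed.

HB.instance Definition _ := GRing.isLinear.Build F _ _ _ jet jet_linear.
HB.instance Definition _ := GRing.isMonoidMorphism.Build _ _ jet jet_monoid.

Lemma jet_coef S T : jet S = jet T -> S v = T v.
Proof.
move/(@flatten_mx_inj F m l.+1 l.+1)/matrixP/(_ ord0 ord_max); rewrite !mxE /=.
by rewrite subn0 drop0 take_size.
Qed.

End Jets.

(** Jets of series are matrices of some finite size, where the equivalence
    applies. *)
Lemma expansion_equiv m (p : point F g m) (r1 r2 : rexpr F g) :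
  requiv r1 r2 -> rdefined p r1 -> rdefined p r2 ->
  expansion p r1 = expansion p r2.
Proof.
move=> r12 /expansion_defined[p1 _] /expansion_defined[p2 _].
apply/funext => v; apply: jet_coef.
have [d1 e1] := reval_morph (@jet m v) p1.
have [d2 e2] := reval_morph (@jet m v) p2.
by rewrite -[LHS]e1 -[RHS]e2; apply: r12.
Qed.

End Morphisms.

(** * A common point of two domains *)

Section Lines.
Variables (F : fieldType) (g m : nat).

Definition line_point (p q : point F g m) (t : F) : point F g m :=
  fun x => p x + t *: (q x - p x).

Lemma line_point0 p q : line_point p q 0 = p.
Proof. by apply/funext => x; rewrite /line_point scale0r addr0. Qed.

Lemma line_point_rev p q t : line_point p q t = line_point q p (1 - t).
Proof.
apply/funext => x; rewrite /line_point.
rewrite -(opprB (p x) (q x)) scalerN scalerBl scale1r addrA.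
by rewrite [X in _ = X - _]addrC subrK.
Qed.

Local Notation evmx t := (map_mx (horner_eval t)).

(** Along a line that starts in the domain, the value is a matrix of rational
    functions of the parameter t with a common denominator D. Where D does not
    vanish the expression is still defined. For an inverse, the adjugate of
    the numerator is used and its determinant joins the denominator. *)
Lemma rational_on_line (p q : point F g m) r : rdefined p r ->
  exists (D : {poly F}) (N : 'M[{poly F}]_m.+1), D.[0] != 0 /\
    forall t, D.[t] != 0 -> rdefined (line_point p q t) r /\
      D.[t] *: reval (line_point p q t) r = evmx t N.
Proof.
elim: r => [c|x|r1 IH1 r2 IH2|r1 IH1 r2 IH2|r1 IH1] //=.
- exists 1, (c%:P)%:M; rewrite hornerC oner_neq0; split=> // t _; split=> //.
  by rewrite hornerC scale1r map_scalar_mx /= /horner_eval hornerC scalemx1.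
- exists 1, (map_mx polyC (p x) + 'X *: map_mx polyC (q x - p x)).
  rewrite hornerC oner_neq0; split=> // t _; split=> //.
  rewrite hornerC scale1r; apply/matrixP => i j; rewrite !mxE /horner_eval.
  by rewrite !hornerE.
- case/andP=> /IH1[D1 [N1 [D10 IH1']]] /IH2[D2 [N2 [D20 IH2']]].
  exists (D1 * D2), (D2 *: N1 + D1 *: N2); rewrite hornerM mulf_neq0 //.
  split=> // t; rewrite hornerM mulf_eq0 negb_or.
  move=> /andP[/IH1'[d1 e1] /IH2'[d2 e2]].
  split; first exact/andP.
  rewrite map_mxD !map_mxZ /= /horner_eval -e1 -e2 !scalerA scalerDr.
  by rewrite [D2.[t] * _]mulrC.
- case/andP=> /IH1[D1 [N1 [D10 IH1']]] /IH2[D2 [N2 [D20 IH2']]].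
  exists (D1 * D2), (N1 * N2); rewrite hornerM mulf_neq0 //.
  split=> // t; rewrite hornerM mulf_eq0 negb_or.
  move=> /andP[/IH1'[d1 e1] /IH2'[d2 e2]].
  split; first exact/andP.
  by rewrite rmorphM /= -e1 -e2 -scalerAl -scalerAr scalerA.
case/andP=> r1p; have [D1 [N1 [D10 IH1']]] := IH1 r1p => u.
exists (D1 * \det N1), (D1 ^+ 2 *: \adj N1).
have detE t : (\det N1).[t] = \det (evmx t N1) by rewrite det_map_mx.
split.
  rewrite hornerM mulf_neq0 // detE; have [_ <-] := IH1' _ D10.
  by rewrite line_point0 detZ mulf_neq0 ?expf_neq0 // -unitfE.
move=> t Dt.
have /andP[Dt1 Nt] : (D1.[t] != 0) && ((\det N1).[t] != 0).
  by rewrite -negb_or -mulf_eq0 -hornerM.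
have [d e] := IH1' _ Dt1.
have ut : reval (line_point p q t) r1 \is a GRing.unit.
  move: Nt; rewrite detE -e detZ mulf_eq0 negb_or => /andP[_ dett].
  by rewrite -[_ \is a _]/(_ \in unitmx) unitmxE unitfE.
split; first exact/andP.
apply: (mulrI ut); rewrite -scalerAr divrr // map_mxZ /= map_mx_adj -e.
rewrite /horner_eval hornerM detE -e horner_exp expr2 -!scalerA -scalerAr.
congr (_ *: _); rewrite -scalerAr scalerAl.
by rewrite -[RHS]/(_ *m _) mul_mx_adj scalemx1.
Qed.

End Lines.

Lemma exists_nonroot (F : fieldType) (q : {poly F}) :
  [pchar F] =i pred0 -> q != 0 -> exists t, q.[t] != 0.
Proof.
move=> /pcharf0P char0 q0; pose rs := [seq (i%:R : F) | i <- iota 0 (size q)].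
have urs : uniq rs.
  rewrite map_inj_uniq ?iota_uniq // => i j.
  wlog ij : i j / (i <= j)%N => [hw|] eqij.
    by case/orP: (leq_total i j) => [/hw->|/hw->].
  have /eqP := congr1 (fun z => z - i%:R) (esym eqij).
  rewrite subrr -natrB // char0 subn_eq0 => ji.
  by apply/eqP; rewrite eqn_leq ij.
have /allPn[t _ qt] : ~~ all (root q) rs.
  apply/negP => /(max_poly_roots q0)/(_ urs).
  by rewrite size_map size_iota ltnn.
by exists t.
Qed.

(** With p (x) 1 and 1 (x) q of the same size, only finitely many parameters
    t of the line through them are excluded by either denominator; the two
    denominators start from opposite ends, hence the substitution of 1 - t. *)
Lemma common_point (F : fieldType) g (r1 r2 : rexpr F g) :
  [pchar F] =i pred0 -> rnondegenerate r1 -> rnondegenerate r2 ->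
  exists m (s : point F g m), rdefined s r1 /\ rdefined s r2.
Proof.
move=> charF [m [p pr1]] [k [q qr2]].
have [p'r1 _] := reval_morph (amplify_right (m := m) k) pr1.
have [q'r2 _] := reval_morph (amplify_left m (k := k)) qr2.
set p' := _ \o p in p'r1; set q' := _ \o q in q'r2.
have [D1 [N1 [D10 r1D]]] := rational_on_line q' p'r1.
have [D2 [N2 [D20 r2D]]] := rational_on_line p' q'r2.
have [|t] := @exists_nonroot F (D1 * (D2 \Po (1 - 'X))) charF.
  rewrite mulf_neq0 //; first by apply: contraNneq D10 => ->; rewrite horner0.
  apply: contraNneq D20 => /(congr1 (horner^~ 1)).
  by rewrite horner_comp !hornerE subrr => ->.
rewrite hornerM horner_comp !hornerE mulf_eq0 negb_or.
move=> /andP[/r1D[d1 _] /r2D[d2 _]].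
exists _, (line_point p' q' t); split=> //.
by rewrite line_point_rev.
Qed.

Theorem theorem5p10 (F : fieldType) (charF : [pchar F] =i pred0)
    (g : nat) (R : ncratfun F g) :
  exists d : nat, forall (m : nat) (p : point F g m), rfdom R p ->
    (exists L : linrep F g m d, minimal_realization R p L) /\
    (forall (n : nat) (L : linrep F g m n), minimal_realization R p L -> n = d).
Proof.
have [r0 nd0 reprE] := representsP R.
have [d d_min] := minimal_dim_of_expr r0; exists d.
(* Every representative is compared with the fixed r0, because requiv is not
   obviously transitive: the middle expression has its own domain. *)
have dimE r : represents R r -> forall m (p : point F g m), rdefined p r ->
    (exists L : linrep F g m d, represents_series L (expansion p r)) /\
    (forall n (L : linrep F g m n), represents_series L (expansion p r) ->
       (d <= n)%N).
  case/reprE => ndr r0r; have [e e_min] := minimal_dim_of_expr r.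
  have [m [s [sr0 sr]]] := common_point charF nd0 ndr.
  suff -> : d = e by [].
  have [[L0 L0s] d_le] := d_min _ _ sr0; have [[L Ls] e_le] := e_min _ _ sr.
  have eqs := expansion_equiv r0r sr0 sr.
  apply/eqP; rewrite eqn_leq; apply/andP; split.
    by apply: (d_le _ L); rewrite eqs.
  by apply: (e_le _ L0); rewrite -eqs.
move=> m p [r Rr pr].
have [[L Lr] _] := dimE r Rr m p pr.
have Lmin : minimal_realization R p L.
  split; first by exists r.
  move=> n' L' [r' [Rr' pr' L'r']].
  by have [_ d_le] := dimE r' Rr' m p pr'; apply: d_le L'r'.
split=> [|n L' [[r' [Rr' pr' L'r']] L'min]]; first by exists L.
apply/eqP; rewrite eqn_leq (L'min _ L) /=; last by case: Lmin.
by have [_ d_le] := dimE r' Rr' m p pr'; apply: d_le L'r'.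
Qed.
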